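(* Let $n\ge 1$, let $(\langle\cdot,\cdot\rangle,J)$ be the Kählerian structure on $\mathbb{CP}^n$ given by the Fubini–Study metric $g=\langle\cdot,\cdot\rangle$ and the tensor $J$, and let $R^\nabla$ be the Riemannian curvature tensor of $g$. Consider the sub-Riemannian structure $(\mathbb S^{2n+1},\mathcal H,d_{\mathcal H})$ associated with the complex Hopf fibration $\pi:\mathbb S^{2n+1}\to\mathbb{CP}^n$. Let $\lambda=(p,z)\in\mathcal H_{1/2}$ with $z\in\mathbb S^{2n+1}$, $p\in T_z^*\mathbb S^{2n+1}$, and write $u_0=u_0(\lambda)$. Then for every $v\in\mathcal V_c(\lambda)$, $$g\big((\mathfrak R_\lambda(c,c)(v))^h,v^h\big)=g\big(R^\nabla(p^h,v^h)p^h,v^h\big)+\frac{u_0^2}{4}\|v\|^2,$$ $$\mathfrak R_\lambda(c,b)(v)=g\big(R^\nabla(p^h,Jp^h)p^h,v^h\big)\,\mathcal E_b(\lambda),$$ $$\rho_\lambda(b,b)=g\big(R^\nabla(p^h,Jp^h)p^h,Jp^h\big)+u_0^2,$$ $$\mathfrak R_\lambda(c,a)=0\quad\text{and}\quad \mathfrak R_\lambda(a,a)=0,$$ where $\mathcal E_b(\lambda)=(Jp^h)^v\in\mathcal V_b(\lambda)$ and $\rho_\lambda(b,b)\in\mathbb R$ is defined by $\mathfrak R_\lambda(b,b)v_b=\rho_\lambda(b,b)v_b$ for all $v_b\in\mathcal V_b(\lambda)$.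
   Context: **Sub-Riemannian structure.** $\mathbb S^{2n+1}\subset\mathbb C^{n+1}$ is the unit sphere with the round metric, and $\pi:\mathbb S^{2n+1}\to\mathbb{CP}^n$ is the Hopf fibration (quotient by the scalar action of $U(1)$). $\mathbb{CP}^n$ carries the Fubini–Study metric $g$ for which $\pi$ is a Riemannian submersion. $V(z)=iz$ is the vertical unit vector field. $\mathcal H_z$ is the orthogonal complement of $\mathbb RV(z)$ in $T_z\mathbb S^{2n+1}$. $d_{\mathcal H}$ is the restriction of the round metric to $\mathcal H$, so $d_{\mathcal H}=\pi^*g$. The distribution $\mathcal H$ is a contact distribution. With $\omega$ the connection 1-form of the principal connection $\mathcal H$, the curvature form $d\omega$ induces the $(1,1)$ tensor $J$ on $\mathbb{CP}^n$ by $g(JX,Y)=d\omega(X,Y)$, and $(J,g)$ is a Kählerian structure on $\mathbb{CP}^n$. Sign convention: $g(R^\nabla(X,Y)X,Y)$ is the sectional curvature of the plane spanned by $X,Y$ when $X,Y$ are orthonormal. **Hamiltonian and extremals.** On $T^*\mathbb S^{2n+1}$ let $\sigma=-d\varsigma$, with $\varsigma$ the tautological 1-form, and define $\vec h$ by $i_{\vec h}\sigma=dh$, where $h(p,z)=\frac12\|p|_{\mathcal H_z}\|^2$. Put $\mathcal H_{1/2}=\{\lambda: h(\lambda)=\frac12\}$ and $u_0(p,z)=p\cdot V(z)$. Normal extremals are the trajectories of $\vec h$. **Jacobi curve.** Let $\Pi_\lambda=\{\xi\in T_\lambda\mathcal H_{1/2}: \xi \text{ is tangent to the fiber } T_z^*\mathbb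 S^{2n+1}\}$, which has dimension $2n$. The Jacobi curve at $\lambda$ is $\mathcal J_\lambda(t)=e^{-t\vec h}_*(\Pi_{e^{t\vec h}\lambda})/\mathbb R\vec h(\lambda)$. It is a curve of Lagrangian subspaces of the symplectic space $W_\lambda=T_\lambda\mathcal H_{1/2}/\mathbb R\vec h(\lambda)$, whose symplectic form is induced by $\sigma$. The space $\mathcal J_\lambda(0)$ is identified with $\Pi_\lambda$. **Normal moving frame and curvature maps.** A normal moving frame of $\mathcal J_\lambda$ is a moving Darboux frame $(E_a,E_b,E_c,F_a,F_b,F_c)(t)$ of $W_\lambda$. This means that the $E$'s pair to zero with each other, the $F$'s pair to zero with each other, and $\sigma(E_i,F_j)=\delta_{ij}$. Here $E_a,E_b,F_a,F_b$ are single vectors and $E_c,F_c$ are $(2n-2)$-tuples (absent if $n=1$). The frame is required to satisfy $\mathcal J_\lambda(t)=\mathrm{span}\{E_a(t),E_b(t),E_c(t)\}$ and $$E_a'=E_b,\quad E_b'=F_b,\quad E_c'=F_c,$$ $$F_a'=-E_aR_t(a,a)-E_cR_t(a,c),$$ $$F_b'=-F_a-E_bR_t(b,b)-E_cR_t(b,c),$$ $$F_c'=-E_aR_t(a,c)^T-E_bR_t(b,c)^T-E_cR_t(c,c),$$ with $R_t(a,a),R_t(b,b)\in\mathbb R$, $R_t(a,c),R_t(b,c)\in\mathbb R^{(2n-2)\times1}$, and $R_t(c,c)$ a symmetric $(2n-2)\times(2n-2)$ matrix. Such a frame exists. It is unique up to a common sign of $(E_a,E_b)$ and a constant orthogonal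 change of $E_c$. Hence $\Pi_\lambda=\mathcal V_a(\lambda)\oplus\mathcal V_b(\lambda)\oplus\mathcal V_c(\lambda)$, where $\mathcal V_s(\lambda)=\mathrm{span}\,E_s(0)$, and $E_s(0)$ is declared an orthonormal basis of $\mathcal V_s(\lambda)$; $\|\cdot\|$ is the resulting norm. For $s_1,s_2\in\{a,b,c\}$ the $(s_1,s_2)$-curvature $\mathfrak R_\lambda(s_1,s_2):\mathcal V_{s_1}(\lambda)\to\mathcal V_{s_2}(\lambda)$ is the linear map with matrix $R_0(s_1,s_2)$ in the bases $E_{s_1}(0),E_{s_2}(0)$, where $R_t(c,a)=R_t(a,c)^T$ and $R_t(c,b)=R_t(b,c)^T$. **Identifications.** Fibers of $T^*\mathbb S^{2n+1}$ are identified with their tangent spaces, and $\mathcal H_z^*\cong\mathcal H_z$ via $d_{\mathcal H}$. Since $\pi_*:\mathcal H_z\to T_{\pi(z)}\mathbb{CP}^n$ is an isometry, $J$ is also viewed as an antisymmetric operator on $\mathcal H_z$. For a covector $v$ at $z$ (in particular $v=p$ or $v\in\Pi_\lambda$), $v^h\in T_{\pi(z)}\mathbb{CP}^n$ is the image under $\pi_*$ of the vector in $\mathcal H_z$ dual to $v|_{\mathcal H_z}$. Conversely, for $X\in T_{\pi(z)}\mathbb{CP}^n$, $X^v$ is the horizontal lift of $X$ to $\mathcal H_z$, regarded via these identifications as a vertical vector at $\lambda$. Under these identifications $\mathcal V_a(\lambda)$ is the annihilator of $\mathcal H_z$, $\mathcal V_b(\lambda)=\mathbb R\,(Jp^h)^v$,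 and $\mathcal V_c(\lambda)$ corresponds to the orthogonal complement of $\mathbb R\,Jp^h$ inside $\mathcal V_b(\lambda)\oplus\mathcal V_c(\lambda)$.
   Formalization: With unit sphere and V(z)=iz the tensor J from dω satisfies J²=-4, and the formulas fail; the formal theorem takes a sphere of radius r and V(z)=νiz with J²=-1 assumed (so νr²=2), e.g. the unit sphere with V=2iz and u_0=p·V. *)

(* Defs.v *)
From HB Require Import structures.
From mathcomp Require Import all_boot all_order all_algebra.
From mathcomp Require Import all_classical all_reals all_analysis.
Set Implicit Arguments.
Unset Strict Implicit.
Unset Printing Implicit Defensive.
Import Order.TTheory GRing.Theory Num.Theory.
Import numFieldNormedType.Exports.
Local Open Scope classical_set_scope.
Local Open Scope ring_scope.

Section calculus.
Context {R : realType}.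

(* Submanifolds are subsets M of an ambient space; T_xM is the set of
   velocities at x of the curves contained in M. *)
Definition tangent (X : normedModType R) (M : set X) (x u : X) : Prop :=
  exists c : R -> X,
    [/\ \forall s \near (0 : R), M (c s), c 0 = x & is_derive (0 : R) 1 c u].

(* v = f_* u for a map f defined on M and u tangent to M at x; the values of f
   outside M are irrelevant. *)
Definition pushforward (X : normedModType R) (M : set X) (f : X -> X)
    (x u v : X) : Prop :=
  exists c : R -> X,
    [/\ \forall s \near (0 : R), M (c s), c 0 = x,
        is_derive (0 : R) 1 c u & is_derive (0 : R) 1 (f \o c) v].

(* Exterior derivative of a 1-form alpha x u; u and v are extended to constant
   vector fields, which commute. The exterior derivative of the restriction of
   alpha to a submanifold is the restriction of this one. *)
Definition ext_deriv (X : normedModType R) (alpha : X -> X -> R) (x u v : X) : R :=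
  'D_u (alpha ^~ v) x - 'D_v (alpha ^~ u) x.

Definition is_flow (X : normedModType R) (M : set X) (xi : X -> X)
    (Phi : R -> X -> X) : Prop :=
  forall x, M x ->
    Phi 0 x = x /\
    forall t, M (Phi t x) /\ is_derive t 1 (Phi ^~ x) (xi (Phi t x)).

(* For a metric g in a chart whose range is (an open subset of) the linear
   space H, the Levi-Civita connection is nabla_X Y = D_X Y + Gam X Y. *)
Definition is_christoffel (X : normedModType R) (H : set X)
    (g : X -> X -> X -> R) (Gam : X -> X -> X -> X) : Prop :=
  forall w u v, H w -> H u -> H v ->
    H (Gam w u v) /\
    forall y, H y ->
      2 * g w (Gam w u v) y =
        'D_u (fun w' => g w' v y) w + 'D_v (fun w' => g w' u y) w
        - 'D_y (fun w' => g w' u v) w.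

(* nabla_v nabla_u y - nabla_u nabla_v y for constant u, v, y: with this sign
   g (riemann u v u) v is the sectional curvature for orthonormal u, v. *)
Definition riemann (X : normedModType R) (Gam : X -> X -> X -> X) (w u v y : X) : X :=
  ('D_v (fun w' => Gam w' u y) w + Gam w v (Gam w u y))
  - ('D_u (fun w' => Gam w' v y) w + Gam w u (Gam w v y)).

End calculus.

(* z : CC R n stands for the point z.1 + i z.2 of C^(n+1). *)
Notation CC R n := ('rV[R]_n.+1 * 'rV[R]_n.+1)%type.

(* A covector p at a point z of the sphere is represented by the vector of
   T_z S dual to it for the Euclidean product: the point (p, z) of T^*S becomes
   a pair of vectors with dot p z = 0. *)
Notation Phase R n := (CC R n * CC R n)%type.

Section hopf.
Context {R : realType} {n : nat}.
Implicit Types (r nu : R) (z X Y : CC R n) (lam xi eta : Phase R n).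

Definition dot X Y : R :=
  \sum_(j < n.+1) (X.1 ord0 j * Y.1 ord0 j + X.2 ord0 j * Y.2 ord0 j).

Definition mulI X : CC R n := (- X.2, X.1).

(* The sphere of radius r carries the metric induced by dot; the vertical field
   V(z) = nu i z has length nu r. The two normalizations are kept free because
   they decide whether (J, g) is Kaehlerian, see kahlerian below. *)
Definition sphere r : set (CC R n) := [set z | dot z z = r ^+ 2].

Definition vert nu z : CC R n := nu *: mulI z.

Definition horizontal z : set (CC R n) :=
  [set X | dot X z = 0 /\ dot X (mulI z) = 0].

Definition hor z X : CC R n :=
  X - (dot X z / dot z z) *: z - (dot X (mulI z) / dot z z) *: mulI z.

(* The connection form, with value 1 on V and kernel H on TS. *)
Definition connection nu z X : R :=
  dot (vert nu z) X / dot (vert nu z) (vert nu z).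

(* CP^n in homogeneous coordinates. FS r y X Y is the Fubini-Study product of
   the images of X and Y under the differential at y of C^(n+1) \ 0 -> CP^n,
   that is of y |-> r y / |y| followed by the Riemannian submersion
   pi : sphere r -> CP^n.
   T_[z]CP^n is represented by horizontal z through pi_*, and the metric g of
   CP^n at [z], z in the sphere, is FS r z. *)
Definition FS r y X Y : R :=
  (r ^+ 2 / dot y y) * dot (hor y X) (hor y Y).

(* The Fubini-Study metric in the affine chart w |-> [z + w] of CP^n, where w
   ranges over horizontal z. The differential of this chart at w = 0 is pi_*,
   hence riemann Gam 0 is R^nabla at [z] when Gam is the Levi-Civita connection
   of this metric. *)
Definition FS_chart r z w X Y : R := FS r (z + w) X Y.

(* g(JX, Y) = d omega(X, Y) *)
Definition curvature_tensor r nu (J : CC R n -> CC R n -> CC R n) : Prop :=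
  forall z X, sphere r z -> horizontal z X ->
    horizontal z (J z X) /\
    forall Y, horizontal z Y ->
      FS r z (J z X) Y = ext_deriv (connection nu) z X Y.

(* J^2 = -1. For a J induced by the curvature form this is all that being
   Kaehlerian requires: the fundamental form is then closed and J is skew, so
   that g is Hermitian, and J is a constant multiple of multiplication by i.
   It amounts to nu r^2 = 2, because d omega(X, Y) = 2 / (nu r^2) g(iX, Y). In
   particular it rules out r = nu = 1, for which J = 2i. *)
Definition kahlerian r (J : CC R n -> CC R n -> CC R n) : Prop :=
  forall z X, sphere r z -> horizontal z X -> J z (J z X) = - X.

Definition cotangent r : set (Phase R n) :=
  [set lam | sphere r lam.2 /\ dot lam.1 lam.2 = 0].

(* sigma = - d varsigma, varsigma being the tautological 1-form. *)
Definition tautological lam xi : R := dot lam.1 xi.2.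

Definition sigma lam xi eta : R := - ext_deriv tautological lam xi eta.

Definition energy lam : R :=
  2^-1 * dot (hor lam.2 lam.1) (hor lam.2 lam.1).

Definition unit_level r : set (Phase R n) :=
  [set lam | cotangent r lam /\ energy lam = 2^-1].

Definition u0 nu lam : R := dot lam.1 (vert nu lam.2).

Definition hamiltonian_field r (hvec : Phase R n -> Phase R n) : Prop :=
  forall lam, cotangent r lam ->
    tangent (cotangent r) lam (hvec lam) /\
    forall eta, tangent (cotangent r) lam eta ->
      sigma lam (hvec lam) eta = 'D_eta energy lam.

(* Pi_lam; the vectors tangent to the fiber are those of the form (v, 0). *)
Definition fiber_tangent r lam : set (Phase R n) :=
  [set xi | tangent (unit_level r) lam xi /\ xi.2 = 0].

(* (e^(-t hvec))_* Pi_(e^(t hvec) lam), a subspace of T_lam H_(1/2) which the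
   projection modulo hvec lam maps isomorphically onto the Jacobi curve at
   time t. *)
Definition jacobi_curve r (flow : R -> Phase R n -> Phase R n) lam (t : R) :
    set (Phase R n) :=
  [set xi | exists2 eta, fiber_tangent r (flow t lam) eta &
     pushforward (unit_level r) (flow (- t)) (flow t lam) eta xi].

(* f'(t) = u modulo the line spanned by d *)
Definition deriv_mod (d : Phase R n) (f : R -> Phase R n) (t : R)
    (u : Phase R n) : Prop :=
  exists k : R, is_derive t 1 f (u + k *: d).

(* v^h for a vertical vector v = (v.1, 0), and X^v; similarly p^h is
   hor lam.2 lam.1. *)
Definition to_base lam (v : Phase R n) : CC R n := hor lam.2 v.1.
Definition to_vertical X : Phase R n := (X, 0).

End hopf.

Record moving_frame (R : realType) (n : nat) := MovingFrame {
  Ea : R -> Phase R n;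
  Eb : R -> Phase R n;
  Ec : R -> (2 * n - 2).-tuple (Phase R n);
  Fa : R -> Phase R n;
  Fb : R -> Phase R n;
  Fc : R -> (2 * n - 2).-tuple (Phase R n);
  Raa : R -> R;
  Rbb : R -> R;
  Rac : R -> 'cV[R]_(2 * n - 2);
  Rbc : R -> 'cV[R]_(2 * n - 2);
  Rcc : R -> 'M[R]_(2 * n - 2)
}.

Section frames.
Context {R : realType} {n : nat}.
Implicit Types (fr : moving_frame R n) (lam : Phase R n).

Definition Eall fr (t : R) : (2 * n - 2).+2.-tuple (Phase R n) :=
  [tuple of Ea fr t :: Eb fr t :: Ec fr t].
Definition Fall fr (t : R) : (2 * n - 2).+2.-tuple (Phase R n) :=
  [tuple of Fa fr t :: Fb fr t :: Fc fr t].

(* Vectors of W_lam = T_lam H_(1/2) / R hvec lam are given by representatives: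
   E_s(t) by its unique representative in (e^(-t hvec))_* Pi, and F_s(t) by an
   arbitrary one. Equalities between derivatives hold modulo hvec lam. *)
Definition normal_frame (r : R) (hvec : Phase R n -> Phase R n)
    (flow : R -> Phase R n -> Phase R n) lam fr : Prop :=
  forall t,
    [/\ forall xi, xi \in span (Eall fr t) <-> jacobi_curve r flow lam t xi,
        forall j, tangent (unit_level r) lam (tnth (Fall fr t) j),
        forall i j,
          [/\ sigma lam (tnth (Eall fr t) i) (tnth (Eall fr t) j) = 0,
              sigma lam (tnth (Fall fr t) i) (tnth (Fall fr t) j) = 0 &
              sigma lam (tnth (Eall fr t) i) (tnth (Fall fr t) j) = (i == j)%:R],
        [/\ deriv_mod (hvec lam) (Ea fr) t (Eb fr t),
            deriv_mod (hvec lam) (Eb fr) t (Fb fr t) &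
            forall j, deriv_mod (hvec lam) (fun s => tnth (Ec fr s) j) t
                                (tnth (Fc fr t) j)] &
        [/\ deriv_mod (hvec lam) (Fa fr) t
              (- (Raa fr t *: Ea fr t)
               - \sum_i Rac fr t i ord0 *: tnth (Ec fr t) i),
            deriv_mod (hvec lam) (Fb fr) t
              (- Fa fr t - Rbb fr t *: Eb fr t
               - \sum_i Rbc fr t i ord0 *: tnth (Ec fr t) i),
            forall j, deriv_mod (hvec lam) (fun s => tnth (Fc fr s) j) t
              (- (Rac fr t j ord0 *: Ea fr t) - Rbc fr t j ord0 *: Eb fr t
               - \sum_i Rcc fr t i j *: tnth (Ec fr t) i) &
            (Rcc fr t)^T = Rcc fr t]].

(* The linear map span X -> span Y with matrix A in the bases X and Y. *)
Definition map_of_matrix (m k : nat) (X : m.-tuple (Phase R n))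
    (Y : k.-tuple (Phase R n)) (A : 'M[R]_(k, m)) (v : Phase R n) : Phase R n :=
  \sum_i (\sum_j A i j * coord X j v) *: tnth Y i.

Definition Va fr := span [tuple Ea fr 0].
Definition Vb fr := span [tuple Eb fr 0].
Definition Vc fr := span (Ec fr 0).

(* The norm of Vc that makes E_c(0) orthonormal, squared. *)
Definition sqnorm_c fr (v : Phase R n) : R := \sum_i coord (Ec fr 0) i v ^+ 2.

Definition curv_cc fr := map_of_matrix (Ec fr 0) (Ec fr 0) (Rcc fr 0).
Definition curv_cb fr := map_of_matrix (Ec fr 0) [tuple Eb fr 0] (Rbc fr 0)^T.
Definition curv_ca fr := map_of_matrix (Ec fr 0) [tuple Ea fr 0] (Rac fr 0)^T.
Definition curv_bb fr := map_of_matrix [tuple Eb fr 0] [tuple Eb fr 0] (Rbb fr 0)%:M.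
Definition curv_aa fr := map_of_matrix [tuple Ea fr 0] [tuple Ea fr 0] (Raa fr 0)%:M.

End frames.

(* Main.v *)
Require Import Defs.
From HB Require Import structures.
From mathcomp Require Import all_boot all_order all_algebra.
From mathcomp Require Import all_classical all_reals all_analysis.
From mathcomp Require Import ring lra.
Import Order.TTheory GRing.Theory Num.Theory.
Import numFieldNormedType.Exports.
Local Open Scope ring_scope.

(** Write [i] for [mulI], [w = hor z p] for the velocity of the extremal
    through [lam = (p, z)], [k = dot p (i z) / r ^+ 2] for its normalized
    vertical momentum, and [om ^+ 2 = 1 / r ^+ 2 + k ^+ 2]. On the unit level
    [|w| = 1]. The form [d omega] is a constant multiple of
    [(X, Y) |-> dot (i X) Y], so the Kaehler condition forces [J = i] and
    [nu * r ^+ 2 = 2] ([kahlerian_mulI]), whence [u0 = 2 * k].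

    Everything rests on an explicit integration. The Hamiltonian is the energy
    of the round sphere minus half the square of the momentum along the unit
    vertical vector; the two Poisson commute, so the flow is the geodesic flow
    of the sphere, a rotation of frequency [om], composed with the scalar
    rotation of angle [- k * t] ([flowE]). Differentiating this closed form along curves with a fixed base
    point gives every vector of the Jacobi curve as
    [al *: ea t + be *: eb t + e u t], where [ea 0] is along the fiber
    direction [i z], [eb 0] is [i w], [e u 0] is [u] for [u] orthogonal to
    [z], [i z], [w] and [i w] ([jacobi_curve_model]), and
    [ea' = eb], [eb' = fb], [fb' = - fa - 4 om^2 eb], [fa' = 0],
    [e'' = - om^2 e]. Up to a factor, and modulo the Hamiltonian field, [fa] is
    the generator of the scalar rotations, which are symmetries of the flow: this
    is why its derivative vanishes. So the model satisfies the equations of a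
    normal frame with [Rbb = 4 om^2], [Rcc = om^2] and all other curvatures
    zero.

    It remains to see that the given frame has the same curvatures
    ([normal_frame_rigid]). The vectors [Ea], [Eb], [Ec] lie in the isotropic span
    of [ea], [eb] and the [e u], so their pairings with these vanish identically;
    differentiating such relations repeatedly identifies the frames up to a
    common sign of [(Ea, Eb)] and a constant change of [Ec]. The quotient by the Hamiltonian
    vector field is realized by the projection [reduce] onto the hyperplane of
    vectors whose base component is orthogonal to [w], so that equalities modulo
    that field become equalities.

    On the base, the Levi-Civita connection of the Fubini-Study metric in the
    affine chart is determined by its Koszul formula ([FS_christoffelE]), and
    its first derivative at the origin gives the usual curvature tensor of
    constant holomorphic curvature [4 / r ^+ 2] ([FS_riemann]). With
    [om ^+ 2 = 1 / r ^+ 2 + u0 ^+ 2 / 4] the formulas of the theorem can be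
    read off. *)

Set Implicit Arguments.
Unset Strict Implicit.
Unset Printing Implicit Defensive.

(** * Derivatives of curves *)

Section curves.
Local Open Scope classical_set_scope.
Local Open Scope ring_scope.
Context {R : realType}.
Implicit Types (V W : normedModType R) (f g : R -> R) (t : R).

(** Commutation with difference quotients is all the linearity needed. *)
Lemma is_derive_linear V W (L : V -> W) (f : R -> V) (t : R) df :
  (forall a x y, L (a *: (x - y)) = a *: (L x - L y)) -> continuous L ->
  is_derive t 1 f df -> is_derive t 1 (L \o f) (L df).
Proof.
move=> Llin Lc [fd fE].
have H : (fun h => h^-1 *: ((f \o shift t) (h *: (1:R)) - f t)) @ 0^' --> df.
  by rewrite -fE; exact: fd.
have H2 : (fun h => h^-1 *: (((L \o f) \o shift t) (h *: (1:R)) - (L \o f) t)) @ 0^' --> L df.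
  have -> : (fun h => h^-1 *: (((L \o f) \o shift t) (h *: (1:R)) - (L \o f) t)) =
            L \o (fun h => h^-1 *: ((f \o shift t) (h *: (1:R)) - f t)).
    by apply/funext => h /=; rewrite Llin.
  by apply: cvg_comp H _; exact: Lc.
by split; [apply/cvg_ex; exists (L df) | exact: cvg_lim H2].
Qed.

Lemma is_derive_unique V (f : R -> V) (t : R) u v :
  is_derive t 1 f u -> is_derive t 1 f v -> u = v.
Proof. by move=> [_ <-] [_ <-]. Qed.

Lemma is_derive_fst V W (f : R -> V * W) (t : R) df :
  is_derive t 1 f df -> is_derive t 1 (fun s => (f s).1) df.1.
Proof.
apply: (@is_derive_linear (V * W)%type V fst) => // x; exact: cvg_fst.
Qed.

Lemma is_derive_snd V W (f : R -> V * W) (t : R) df :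
  is_derive t 1 f df -> is_derive t 1 (fun s => (f s).2) df.2.
Proof.
apply: (@is_derive_linear (V * W)%type W snd) => // x; exact: cvg_snd.
Qed.

Lemma is_derive_entry m n (f : R -> 'M[R]_(m.+1, n.+1)) (t : R) df i j :
  is_derive t 1 f df -> is_derive t 1 (fun s => f s i j) (df i j).
Proof.
move=> fd.
split; first by have := (derivable_mxP _ _ _).1 (@ex_derive _ _ _ _ _ _ _ fd) i j.
by rewrite -(@derive_val _ _ _ _ _ _ _ fd) derive_mx ?mxE //; exact: ex_derive.
Qed.

Lemma is_derive_scale V (a : R -> R) (t : R) da (v : V) :
  is_derive t 1 a da -> is_derive t 1 (fun s => a s *: v) (da *: v).
Proof.
apply: (@is_derive_linear R V ( *:%R^~ v)) => [b x y|].
  by rewrite /= -scalerA scalerBl.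
exact: scalel_continuous.
Qed.

Lemma derZr V (a : R) (f : R -> V) (t : R) df : is_derive t 1 f df ->
  is_derive t 1 (fun s => a *: f s) (a *: df).
Proof. exact: is_deriveZ. Qed.

Lemma derD V (f g : R -> V) (t : R) df dg : is_derive t 1 f df -> is_derive t 1 g dg ->
  is_derive t 1 (fun s => f s + g s) (df + dg).
Proof. exact: is_deriveD. Qed.

Lemma derN V (f : R -> V) t df : is_derive t 1 f df ->
  is_derive t 1 (fun s => - f s) (- df).
Proof. exact: is_deriveN. Qed.

Lemma derM f g t df dg : is_derive t 1 f df -> is_derive t 1 g dg ->
  is_derive t 1 (fun s => f s * g s) (df * g t + f t * dg).
Proof.
move=> fd gd; have := is_deriveM fd gd.
by move=> H; apply: is_derive_eq; rewrite /GRing.scale /=; ring.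
Qed.

Lemma derX f n t df : is_derive t 1 f df ->
  is_derive t 1 (fun s => f s ^+ n) (n%:R * f t ^+ n.-1 * df).
Proof.
move=> fd; have := is_deriveX n fd.
have -> : f ^+ n = fun s => f s ^+ n by apply/funext => s; rewrite fctE.
by move=> H; apply: is_derive_eq; rewrite /GRing.scale /=; ring.
Qed.

Lemma derV f t df : f t != 0 -> is_derive t 1 f df ->
  is_derive t 1 (fun s => (f s)^-1) (- (f t) ^- 2 * df).
Proof.
move=> f0 [fd <-]; split; first exact: derivableV.
by rewrite deriveV.
Qed.

Lemma der_comp f g t dg df : is_derive t 1 g dg -> is_derive (g t) 1 f df ->
  is_derive t 1 (fun s => f (g s)) (df * dg).
Proof. by move=> gd fd; have := is_derive1_comp fd gd; rewrite mulrC. Qed.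

(** The differential form of a constraint: this is how the equations of the
    sphere, of its cotangent bundle and of the unit level yield linear
    conditions on their tangent vectors. *)
Lemma near_cst_derive V (f : R -> V) t k df :
  (\forall s \near t, f s = k) -> is_derive t 1 f df -> df = 0.
Proof.
move=> fk fd.
have ck : is_derive t (1 : R) (cst k) df.
  by apply: near_eq_is_derive fd; apply: filterS fk => s ->.
by have := is_derive_unique ck (is_derive_cst k t 1).
Qed.

Lemma der_pair V (W : normedModType R) (f : R -> V) (g : R -> W) t df dg :
  is_derive t 1 f df -> is_derive t 1 g dg ->
  is_derive t 1 (fun s => (f s, g s)) (df, dg).
Proof.
move=> fd gd.
have fd' : is_derive t 1 (fun s => (f s, 0 : W)) (df, 0 : W).
  apply: (is_derive_linear (L := fun x => (x, 0 : W)) _ _ fd) => [a x y|x].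
    by apply: injective_projections => //=; rewrite subrr scaler0.
  by apply: cvg_pair; [exact: cvg_id|exact: cvg_cst].
have gd' : is_derive t 1 (fun s => (0 : V, g s)) (0 : V, dg).
  apply: (is_derive_linear (L := fun x => (0 : V, x)) _ _ gd) => [a x y|x].
    by apply: injective_projections => //=; rewrite subrr scaler0.
  by apply: cvg_pair; [exact: cvg_cst|exact: cvg_id].
have := derD fd' gd'.
have -> : (df, 0 : W) + (0 : V, dg) = (df, dg) by congr pair; rewrite ?addr0 ?add0r.
suff -> : (fun s => (f s, 0 : W) + (0 : V, g s)) = (fun s => (f s, g s)) by [].
by apply/funext => s; congr pair; rewrite ?addr0 ?add0r.
Qed.

(** The difference quotient is a sum of two products of convergent factors. *)
Lemma derZ V (a : R -> R) (X : R -> V) t da dX :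
  is_derive t 1 a da -> is_derive t 1 X dX ->
  is_derive t 1 (fun s => a s *: X s) (da *: X t + a t *: dX).
Proof.
move=> [ad <-] [Xd <-].
suff H : ((fun h : R => h^-1 *: (((fun s => a s *: X s) \o shift t) (h *: (1 : R)) - a t *: X t))
    @ 0^' --> 'D_1 a t *: X t + a t *: 'D_1 X t)%classic.
  by split; [apply/cvg_ex; eexists; exact: H | exact: cvg_lim H].
have -> : (fun h : R => h^-1 *: (((fun s => a s *: X s) \o shift t) (h *: (1 : R)) - a t *: X t)) =
  (fun h : R => (h^-1 *: ((a \o shift t) (h *: (1 : R)) - a t)) *: X t +
     (a \o shift t) (h *: (1 : R)) *: (h^-1 *: ((X \o shift t) (h *: (1 : R)) - X t))).
  apply/funext => h /=; rewrite [in X in _ = _ + X]scalerA [in X in _ = _ + X]mulrC.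
  rewrite -[in X in _ = _ + X]scalerA -[in X in _ = X + _]scalerA -scalerDr.
  by congr (_ *: _); rewrite scalerBl scalerBr [RHS]addrC subrKA.
apply: cvgD; first by apply: cvgZ; [exact: ad|exact: cvg_cst].
apply: cvgZ; last exact: Xd.
suff : {for 0, continuous (fun h : R => a (h *: (1 : R) + t))}.
  by move=> /continuous_withinNx; rewrite scale0r add0r.
exact/differentiable_continuous/derivable1_diffP/(derivable1P _ _ _).1.
Qed.

Lemma derive_line V W (f : V -> W) (x v : V) l :
  is_derive (0 : R) 1 (fun s => f (s *: v + x)) l -> is_derive x v f l.
Proof.
move=> [h1 h2].
have E : (fun h : R => h^-1 *: (((fun s => f (s *: v + x)) \o shift 0) (h *: (1:R)) -
   (fun s => f (s *: v + x)) 0)) =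
   (fun h => h^-1 *: ((f \o shift x) (h *: v) - f x)).
  apply/funext => h /=; congr (_ *: (f _ - f _)); last by rewrite scale0r add0r.
  by rewrite addr0 /GRing.scale /= mulr1.
split; first by move: h1; rewrite /derivable E.
by move: h2; rewrite /derive E.
Qed.

End curves.

(** * The Hermitian space C^(n+1) *)

Section hermitian.
Context {R : realType} {n : nat}.
Implicit Types (X Y Z : CC R n) (a : R).

Lemma CC_eq X Y :
  (forall j, X.1 ord0 j = Y.1 ord0 j) -> (forall j, X.2 ord0 j = Y.2 ord0 j) ->
  X = Y.
Proof.
case: X Y => [x1 x2] [y1 y2] /= h1 h2.
by congr pair; apply/rowP => j.
Qed.

Lemma dotC X Y : dot X Y = dot Y X.
Proof. by apply: eq_bigr => j _; rewrite mulrC [X in _ + X]mulrC. Qed.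

Lemma dotDl X Y Z : dot (X + Y) Z = dot X Z + dot Y Z.
Proof. by rewrite /dot -big_split; apply: eq_bigr => j _ /=; rewrite !mxE; ring. Qed.

Lemma dotZl a X Y : dot (a *: X) Y = a * dot X Y.
Proof. by rewrite /dot mulr_sumr; apply: eq_bigr => j _ /=; rewrite !mxE; ring. Qed.

Lemma dotNl X Y : dot (- X) Y = - dot X Y.
Proof. by rewrite -scaleN1r dotZl mulN1r. Qed.

Lemma dot0l Y : dot 0 Y = 0.
Proof. by rewrite -(scale0r (0 : CC R n)) dotZl mul0r. Qed.

Lemma dotDr X Y Z : dot Z (X + Y) = dot Z X + dot Z Y.
Proof. by rewrite dotC dotDl !(dotC _ Z). Qed.

Lemma dotZr a X Y : dot Y (a *: X) = a * dot Y X.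
Proof. by rewrite dotC dotZl dotC. Qed.

Lemma dotNr X Y : dot Y (- X) = - dot Y X.
Proof. by rewrite dotC dotNl dotC. Qed.

Lemma dot0r Y : dot Y 0 = 0.
Proof. by rewrite dotC dot0l. Qed.

Definition dotE :=
  (dotDl, dotDr, dotNl, dotNr, dotZl, dotZr, dot0l, dot0r).

Lemma dot_suml m (x : 'I_m -> CC R n) (y : CC R n) :
  dot (\sum_i x i) y = \sum_i dot (x i) y.
Proof.
by elim/big_ind2 : _ => [|u a v b <- <-|//]; [exact: dot0l|exact: dotDl].
Qed.

Lemma mulID X Y : mulI (X + Y) = mulI X + mulI Y.
Proof. by apply: CC_eq => j /=; rewrite !mxE; ring. Qed.

Lemma mulIZ a X : mulI (a *: X) = a *: mulI X.
Proof. by apply: CC_eq => j /=; rewrite !mxE; ring. Qed.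

Lemma mulIN X : mulI (- X) = - mulI X.
Proof. by apply: CC_eq => j /=; rewrite !mxE. Qed.

Lemma mulI0 : mulI (0 : CC R n) = 0.
Proof. by apply: CC_eq => j /=; rewrite !mxE ?oppr0. Qed.

Lemma mulII X : mulI (mulI X) = - X.
Proof. by apply: CC_eq => j /=; rewrite !mxE. Qed.

Definition mulIE := (mulID, mulIZ, mulIN, mulI0, mulII).

Lemma dot_mulIl X Y : dot (mulI X) Y = - dot X (mulI Y).
Proof. by rewrite /dot -sumrN; apply: eq_bigr => j _ /=; rewrite !mxE; ring. Qed.

Lemma dot_mulI X Y : dot (mulI X) (mulI Y) = dot X Y.
Proof. by rewrite dot_mulIl mulII dotNr opprK. Qed.

Lemma dot_mulIr X : dot X (mulI X) = 0.
Proof.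
suff /eqP : dot X (mulI X) *+ 2 = 0 by rewrite mulrn_eq0 => /eqP.
by rewrite mulr2n -{1}[dot X (mulI X)]opprK -dot_mulIl dotC addNr.
Qed.

Lemma dot_ge0 X : 0 <= dot X X.
Proof. by apply: sumr_ge0 => j _; rewrite addr_ge0 // -expr2 sqr_ge0. Qed.

Lemma dot_eq0 X : dot X X = 0 -> X = 0.
Proof.
move=> /eqP; rewrite psumr_eq0; last first.
  by move=> j _; rewrite addr_ge0 // -expr2 sqr_ge0.
move=> /allP h.
suff H j : X.1 ord0 j = 0 /\ X.2 ord0 j = 0.
  by apply: CC_eq => j; rewrite !mxE; case: (H j).
have := h j (mem_index_enum _); rewrite -!expr2 paddr_eq0 ?sqr_ge0 //=.
by rewrite !sqrf_eq0 => /andP[/eqP -> /eqP ->].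
Qed.

Lemma is_derive_dot (f g : R -> CC R n) (t : R) df dg :
  is_derive t 1 f df -> is_derive t 1 g dg ->
  is_derive t 1 (fun s => dot (f s) (g s)) (dot df (g t) + dot (f t) dg).
Proof.
move=> fd gd.
have f1 := is_derive_fst fd; have f2 := is_derive_snd fd.
have g1 := is_derive_fst gd; have g2 := is_derive_snd gd.
have H (j : 'I_n.+1) : is_derive t (1 : R)
   ((fun s => (f s).1 ord0 j) * (fun s => (g s).1 ord0 j) +
    (fun s => (f s).2 ord0 j) * (fun s => (g s).2 ord0 j))
   (((f t).1 ord0 j *: dg.1 ord0 j + (g t).1 ord0 j *: df.1 ord0 j) +
   ((f t).2 ord0 j *: dg.2 ord0 j + (g t).2 ord0 j *: df.2 ord0 j)).
  by apply: is_deriveD; apply: is_deriveM; apply: is_derive_entry.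
have := is_derive_sum H.
have -> : (\sum_(j < n.+1) ((fun s => (f s).1 ord0 j) * (fun s => (g s).1 ord0 j) +
    (fun s => (f s).2 ord0 j) * (fun s => (g s).2 ord0 j))) =
    (fun s => dot (f s) (g s)).
  by apply/funext => s; rewrite /dot fct_sumE.
move=> HH; apply: is_derive_eq.
by rewrite /dot -big_split; apply: eq_bigr => j _ /=; rewrite /GRing.scale /=; ring.
Qed.

Lemma is_derive_mulI (f : R -> CC R n) (t : R) df :
  is_derive t 1 f df -> is_derive t 1 (fun s => mulI (f s)) (mulI df).
Proof.
move=> fd; apply: (is_derive_linear (V := CC R n) (W := CC R n)) fd => [a x y|].
  by rewrite !mulIE.
move=> x.
have H1 : ((fun y : CC R n => - y.2) @ x --> - x.2)%classic.
  by apply: cvgN; exact: cvg_snd.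
have H2 : ((fun y : CC R n => y.1) @ x --> x.1)%classic by exact: cvg_fst.
exact: (cvg_pair H1 H2).
Qed.

End hermitian.

Ltac der1 :=
  match goal with
  | H : is_derive ?t 1 ?f _ |- is_derive ?t 1 ?f _ => exact H
  | |- is_derive _ 1 (fun s => ?c) _ => eapply is_derive_cst
  | |- is_derive _ 1 (fun s => s) _ => eapply is_derive_id
  | |- is_derive _ 1 (fun s => (_ : _) + _) _ => eapply derD
  | |- is_derive _ 1 (fun s => - _) _ => eapply derN
  | |- is_derive _ 1 (fun s => _ * _) _ => eapply derM
  | |- is_derive _ 1 (fun s => _ ^+ _) _ => eapply derX
  | |- is_derive _ 1 (fun s => _^-1) _ => eapply derV
  | |- is_derive _ 1 (fun s => dot _ _) _ => eapply is_derive_dot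
  | |- is_derive _ 1 (fun s => mulI _) _ => eapply is_derive_mulI
  | |- is_derive _ 1 (fun s => _ *: _) _ => eapply is_derive_scale
  | |- is_derive _ 1 (fun s => _ *: _) _ => eapply derZ
  | |- is_derive _ 1 ( *%R ?k) _ =>
       eapply (derM (f := fun=> k) (g := fun s => s))
  | |- is_derive _ 1 GRing.opp _ => eapply is_deriveNid
  | |- is_derive _ 1 sin _ => eapply is_derive_sin
  | |- is_derive _ 1 cos _ => eapply is_derive_cos
  | |- is_derive _ 1 (fun s => cos _) _ => eapply (der_comp (f := cos)); [|eapply is_derive_cos]
  | |- is_derive _ 1 (fun s => sin _) _ => eapply (der_comp (f := sin)); [|eapply is_derive_sin]
  | |- is_derive _ 1 (fun s => Num.sqrt _) _ =>
       eapply (der_comp (f := Num.sqrt)); [|eapply is_derive1_sqrt]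
  | |- is_derive _ 1 (fun s => (_, _)) _ => eapply der_pair
  | |- is_derive _ 1 (fun s => fst _) _ => eapply is_derive_fst
  | |- is_derive _ 1 (fun s => snd _) _ => eapply is_derive_snd
  | |- is_derive _ 1 (fun s => fun_of_matrix _ _ _) _ => eapply is_derive_entry
  end.
(** [der] computes the derivative of a curve and leaves the equality between the
    computed and the announced value. *)
Ltac der := eapply is_derive_eq; [repeat der1 | cbv beta].

Ltac coords := apply: CC_eq => j; rewrite /= !mxE.

(** * The symplectic form and the Hamiltonian field *)

Section pairing.
Context {R : realType} {n : nat}.
Implicit Types (x y : Phase R n) (a : R).

(** The value of [sigma], which does not depend on the base point. *)
Definition pairing x y : R := dot y.1 x.2 - dot x.1 y.2.

Lemma pairing_self x : pairing x x = 0.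
Proof. exact: subrr. Qed.

Lemma pairingC x y : pairing y x = - pairing x y.
Proof. by rewrite /pairing opprB. Qed.

Lemma pairingDl x1 x2 y : pairing (x1 + x2) y = pairing x1 y + pairing x2 y.
Proof. by rewrite /pairing /= dotDr dotDl; ring. Qed.

Lemma pairingZl a x y : pairing (a *: x) y = a * pairing x y.
Proof. by rewrite /pairing /= dotZr dotZl; ring. Qed.

Lemma pairingNl x y : pairing (- x) y = - pairing x y.
Proof. by rewrite -scaleN1r pairingZl mulN1r. Qed.

Lemma pairing0l y : pairing 0 y = 0.
Proof. by rewrite -(scale0r (0 : Phase R n)) pairingZl mul0r. Qed.

Lemma pairingDr x1 x2 y : pairing y (x1 + x2) = pairing y x1 + pairing y x2.
Proof. by rewrite pairingC pairingDl !(pairingC _ y); ring. Qed.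

Lemma pairingZr a x y : pairing y (a *: x) = a * pairing y x.
Proof. by rewrite pairingC pairingZl !(pairingC _ y); ring. Qed.

Lemma pairingNr x y : pairing y (- x) = - pairing y x.
Proof. by rewrite pairingC pairingNl !(pairingC _ y); ring. Qed.

Lemma pairing0r y : pairing y 0 = 0.
Proof. by rewrite pairingC pairing0l oppr0. Qed.

Lemma pairing_suml m (x : 'I_m -> Phase R n) y :
  pairing (\sum_i x i) y = \sum_i pairing (x i) y.
Proof.
by elim/big_ind2 : _ => [|u a v b <- <-|//]; [exact: pairing0l|exact: pairingDl].
Qed.

Lemma pairing_sumr m (x : 'I_m -> Phase R n) y :
  pairing y (\sum_i x i) = \sum_i pairing y (x i).
Proof.
by rewrite pairingC pairing_suml -sumrN; apply: eq_bigr => i _; rewrite pairingC opprK.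
Qed.

Lemma der_pairing (f g : R -> Phase R n) (t : R) df dg :
  is_derive t 1 f df -> is_derive t 1 g dg ->
  is_derive t 1 (fun s => pairing (f s) (g s)) (pairing df (g t) + pairing (f t) dg).
Proof. by move=> fd gd; rewrite /pairing; der; ring. Qed.

End pairing.

Definition pairingE := (@pairingDl, @pairingDr, @pairingNl, @pairingNr,
  @pairingZl, @pairingZr, @pairing0l, @pairing0r).

Section hamiltonian.
Context {R : realType} {n : nat}.
Implicit Types (X Y z p : CC R n) (lam xi eta : Phase R n) (r : R).

Lemma hor_dot z X Y :
  dot (hor z X) (hor z Y) =
  dot X Y - dot X z * dot Y z / dot z z
          - dot X (mulI z) * dot Y (mulI z) / dot z z.
Proof.
have e1 : dot z (mulI z) = 0 by exact: dot_mulIr.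
have e2 : dot (mulI z) z = 0 by rewrite dotC.
have e3 : dot (mulI z) (mulI z) = dot z z by exact: dot_mulI.
rewrite /hor !dotE e1 e2 e3 (dotC z Y) (dotC (mulI z) Y).
have [->|zz] := eqVneq (dot z z) 0; first by rewrite invr0; ring.
by field.
Qed.

Lemma energyE lam : energy lam =
  2^-1 * (dot lam.1 lam.1 - dot lam.1 lam.2 ^+ 2 / dot lam.2 lam.2
          - dot lam.1 (mulI lam.2) ^+ 2 / dot lam.2 lam.2).
Proof. by rewrite /energy hor_dot !expr2. Qed.

Lemma sigmaE lam xi eta : sigma lam xi eta = pairing xi eta.
Proof.
have D (u v : Phase R n) : 'D_u ((@tautological R n) ^~ v) lam = dot u.1 v.2.
  apply: derive_val; apply: derive_line.
  rewrite /tautological.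
  have H : is_derive (0 : R) 1 (fun s : R => s *: u + lam) u.
    by der; rewrite scale1r addr0.
  by der; rewrite dot0r addr0.
by rewrite /sigma /ext_deriv !D opprB.
Qed.

Lemma is_derive_energy r lam eta : cotangent r lam -> r != 0 ->
  dot lam.2 eta.2 = 0 ->
  is_derive lam eta energy (dot lam.1 eta.1 - dot lam.1 (mulI lam.2) / r ^+ 2 *
     (dot eta.1 (mulI lam.2) + dot lam.1 (mulI eta.2))).
Proof.
move=> [/= zz pz] r0 ze; apply: derive_line.
have -> : @energy R n = fun lam =>
  2^-1 * (dot lam.1 lam.1 - dot lam.1 lam.2 ^+ 2 / dot lam.2 lam.2
          - dot lam.1 (mulI lam.2) ^+ 2 / dot lam.2 lam.2).
  by apply/funext => x; exact: energyE.
have H : is_derive (0 : R) 1 (fun s : R => s *: eta + lam) eta.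
  by der; rewrite scale1r addr0.
rewrite /sphere /= in zz.
der; rewrite scale0r add0r ?zz ?sqrf_eq0 // pz (dotC eta.2) ze (dotC eta.1 lam.1).
by field.
Qed.

(** The vertical momentum, normalized so that the horizontal velocity of [lam]
    is [lam.1 - momentum r lam *: mulI lam.2]. *)
Definition momentum r lam : R := dot lam.1 (mulI lam.2) / r ^+ 2.

(** Hamilton's equations of [(|p|^2 - (dot p (i z))^2 / r^2) / 2] on the
    cotangent bundle of the sphere; the multiple of [z] in the first component is
    the constraint force keeping the extremal on it. *)
Definition ham_field r lam : Phase R n :=
  (- (dot lam.1 lam.1 / r ^+ 2) *: lam.2 - momentum r lam *: mulI lam.1,
   lam.1 - momentum r lam *: mulI lam.2).

Arguments ham_field : simpl never.

Lemma tangent_cotangent r lam xi : tangent (cotangent r) lam xi ->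
  dot lam.2 xi.2 = 0 /\ dot xi.1 lam.2 + dot lam.1 xi.2 = 0.
Proof.
move=> [c [Mc c0 cd]]; split.
  have H : is_derive (0 : R) 1 (fun s => dot (c s).2 (c s).2) (2 * dot lam.2 xi.2).
    by der; rewrite c0 (dotC xi.2); ring.
  have : 2 * dot lam.2 xi.2 = 0.
    by apply: near_cst_derive H; apply: filterS Mc => s [/= h _]; exact: h.
  by move=> /eqP; rewrite mulf_eq0 pnatr_eq0 /= => /eqP.
have H : is_derive (0 : R) 1 (fun s => dot (c s).1 (c s).2) (dot xi.1 lam.2 + dot lam.1 xi.2).
  by der; rewrite c0.
by apply: (near_cst_derive (k := 0)) H; apply: filterS Mc => s [_ h]; exact: h.
Qed.

Lemma ham_field_tangent r lam : r != 0 -> cotangent r lam ->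
  let h := ham_field r lam in
  dot lam.2 h.2 = 0 /\ dot h.1 lam.2 + dot lam.1 h.2 = 0.
Proof.
rewrite /ham_field /=; move=> r0 [/= zz pz]; rewrite /sphere /= in zz.
rewrite !dotE dot_mulIr (dotC lam.2) pz zz dot_mulIl /momentum; split; first by ring.
by field.
Qed.

Lemma sigma_ham_field r lam eta : r != 0 -> cotangent r lam ->
  dot lam.2 eta.2 = 0 ->
  sigma lam (ham_field r lam) eta = 'D_eta energy lam.
Proof.
move=> r0 Mlam ze; have [_ ->] := is_derive_energy Mlam r0 ze; rewrite sigmaE /pairing /ham_field /=.
rewrite !dotE ze (dotC eta.1 lam.1) dot_mulIl /momentum.
by ring.
Qed.

Lemma tangent_vertical r lam v : cotangent r lam -> dot v lam.2 = 0 ->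
  tangent (cotangent r) lam (v, 0).
Proof.
move=> [/= zz pz] vz; exists (fun s => s *: (v, 0) + lam); split.
- apply: filterE => s; rewrite /cotangent /= scaler0 add0r; split=> //.
  by rewrite !dotE vz pz mulr0 addr0.
- by rewrite scale0r add0r.
by der; rewrite scale1r addr0.
Qed.

(** The curve follows the great circle through [z] in the direction [x] and
    projects [p] onto the tangent spaces along it. *)
Lemma tangent_over r lam x : 0 < r -> cotangent r lam -> dot x lam.2 = 0 ->
  x <> 0 -> exists xi, tangent (cotangent r) lam xi /\ xi.2 = x.
Proof.
move=> r0 [/= zz pz] xz x0; rewrite /sphere /= in zz.
have rn0 : r != 0 by rewrite gt_eqF.
have xx : 0 < dot x x.
  by rewrite lt_neqAle dot_ge0 andbT eq_sym; apply/eqP => /dot_eq0.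
pose m := Num.sqrt (dot x x) / r.
have m0 : m != 0 by rewrite gt_eqF // divr_gt0 // sqrtr_gt0.
have xm : dot x x = m ^+ 2 * r ^+ 2.
  by rewrite /m expr_div_n sqr_sqrtr ?ltW // divfK // sqrf_eq0.
pose Z (s : R) := cos (m * s) *: lam.2 + (sin (m * s) / m) *: x.
pose P (s : R) := lam.1 - (dot lam.1 (Z s) / r ^+ 2) *: Z s.
have Zd : is_derive (0 : R) 1 Z x.
  rewrite /Z; der; rewrite mulr0 sin0 cos0 ?(oppr0,mul0r,scale0r,add0r,mulr1,mul1r,mulr0,addr0).
  rewrite ?(oppr0,mul0r,scale0r,add0r,mulr1,mul1r,mulr0,addr0) mulfV ?scale1r //.
have ZZ s : dot (Z s) (Z s) = r ^+ 2.
  rewrite /Z !dotE zz (dotC lam.2) xz xm; have := cos2Dsin2 (m * s) => cs.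
  transitivity ((cos (m * s) ^+ 2 + sin (m * s) ^+ 2) * r ^+ 2); first by field.
  by rewrite cs mul1r.
have Z0 : Z 0 = lam.2 by rewrite /Z mulr0 cos0 sin0 mul0r scale1r scale0r addr0.
have P0 : P 0 = lam.1 by rewrite /P Z0 pz mul0r scale0r subr0.
suff [dP Pd] : exists dP, is_derive (0 : R) 1 P dP.
  exists (dP, x); split=> //; exists (fun s => (P s, Z s)); split.
  - apply: filterE => s; split; first exact: ZZ.
    by rewrite /= /P dotDl dotNl dotZl ZZ; field.
  - by rewrite P0 Z0; case: (lam).
  by der.
have fd : is_derive (0 : R) 1 (fun s => dot lam.1 (Z s) / r ^+ 2) (dot lam.1 x / r ^+ 2).
  by der; rewrite dot0l; ring.
pose D := fun s => lam.1 - ((dot lam.1 (Z s) / r ^+ 2 * cos (m * s)) *: lam.2 +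
   (dot lam.1 (Z s) / r ^+ 2 * (sin (m * s) / m)) *: x).
have PD : P = D.
  by apply/funext => s; rewrite /D /P {2}/Z scalerDr !scalerA.
by rewrite PD /D; eexists; repeat der1.
Qed.

(** [sigma] is nondegenerate on the cotangent bundle: vertical vectors detect the
    base component of a vector, and vectors over an arbitrary base direction
    detect the fiber component. *)
Lemma hamiltonian_fieldE r hvec lam : 0 < r -> hamiltonian_field r hvec ->
  cotangent r lam -> hvec lam = ham_field r lam.
Proof.
move=> r0 hh Mlam; have rn0 : r != 0 by rewrite gt_eqF.
have [/tangent_cotangent [t2 t1] hs] := hh _ Mlam.
have [u2 u1] := ham_field_tangent rn0 Mlam.
pose d := hvec lam - ham_field r lam.
have E1 : d.1 = (hvec lam).1 - (ham_field r lam).1 by [].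
have E2 : d.2 = (hvec lam).2 - (ham_field r lam).2 by [].
have d2 : dot lam.2 d.2 = 0 by rewrite E2 dotDr dotNr t2 u2 subrr.
have d1 : dot d.1 lam.2 + dot lam.1 d.2 = 0.
  by rewrite E1 E2 dotDl dotNl dotDr dotNr -[RHS](subrr 0) -{1}t1 -u1; ring.
have ds eta : tangent (cotangent r) lam eta -> dot eta.1 d.2 - dot d.1 eta.2 = 0.
  move=> ht; have := hs _ ht; have [e2 _] := tangent_cotangent ht.
  rewrite -(sigma_ham_field rn0 Mlam e2) !sigmaE /pairing => /eqP; rewrite -subr_eq0 => /eqP <-.
  by rewrite E1 E2 dotDl dotNl dotDr dotNr; ring.
have d20 : d.2 = 0.
  apply: dot_eq0; have := ds (d.2, 0) (tangent_vertical Mlam _).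
  by rewrite /= dot0r subr0; apply; rewrite dotC.
have d10 : d.1 = 0.
  rewrite d20 dot0r addr0 in d1.
  have [//|/eqP x0] := eqVneq d.1 0.
  have [eta [et e2]] := tangent_over r0 Mlam d1 x0.
  by apply: dot_eq0; apply/eqP; rewrite -oppr_eq0 -(ds _ et) e2 d20 dot0r sub0r.
by apply/eqP; rewrite -subr_eq0 -/d; apply/eqP; rewrite [d]surjective_pairing d10 d20.
Qed.

End hamiltonian.

(** * Integration of the flow *)

Section flow.
Context {R : realType} {n : nat}.
Implicit Types (X Y z p : CC R n) (lam xi eta x : Phase R n) (r th : R).
Implicit Types (hvec : Phase R n -> Phase R n) (flow : R -> Phase R n -> Phase R n).

(** Multiplication by the unit complex number of angle [th]. *)
Definition crot th X : CC R n := cos th *: X + sin th *: mulI X.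

Lemma crotD th X Y : crot th (X + Y) = crot th X + crot th Y.
Proof. by coords; ring. Qed.
Lemma crotZ th (a : R) X : crot th (a *: X) = a *: crot th X.
Proof. by coords; ring. Qed.
Lemma crotN th X : crot th (- X) = - crot th X.
Proof. by coords; ring. Qed.
Lemma crotI th X : crot th (mulI X) = mulI (crot th X).
Proof. by coords; ring. Qed.
Lemma crotNK th X : crot (- th) (crot th X) = X.
Proof.
have cs := cos2Dsin2 th.
rewrite /crot cosN sinN; coords.
  by transitivity ((cos th ^+ 2 + sin th ^+ 2) * X.1 ord0 j); [ring | rewrite cs mul1r].
by transitivity ((cos th ^+ 2 + sin th ^+ 2) * X.2 ord0 j); [ring | rewrite cs mul1r].
Qed.
Lemma crotK th X : crot th (crot (- th) X) = X.
Proof. by rewrite -{1}(opprK th) crotNK. Qed.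
Lemma crot0 X : crot 0 X = X.
Proof. by rewrite /crot cos0 sin0 scale1r scale0r addr0. Qed.

Lemma dot_crot th X Y : dot (crot th X) (crot th Y) = dot X Y.
Proof.
rewrite /crot !dotE dot_mulI (dot_mulIl X) -[RHS]mul1r -(cos2Dsin2 th); ring.
Qed.

Lemma der_crot (a : R -> R) (X : R -> CC R n) (t : R) da dX :
  is_derive t 1 a da -> is_derive t 1 X dX ->
  is_derive t 1 (fun s => crot (a s) (X s)) (crot (a t) (dX + da *: mulI (X t))).
Proof. by move=> ad Xd; rewrite /crot; der; coords; ring. Qed.

Lemma is_derive_0_cst (f : R -> Phase R n) :
  (forall t : R, is_derive t 1 f 0) -> forall t s, f t = f s.
Proof.
move=> fd t s.
apply: injective_projections; apply: CC_eq => j.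
- apply: (is_derive_0_is_cst (f := fun s => (f s).1.1 ord0 j)) => x; have fx := fd x.
  by der; rewrite /= mxE.
- apply: (is_derive_0_is_cst (f := fun s => (f s).1.2 ord0 j)) => x; have fx := fd x.
  by der; rewrite /= mxE.
- apply: (is_derive_0_is_cst (f := fun s => (f s).2.1 ord0 j)) => x; have fx := fd x.
  by der; rewrite /= mxE.
apply: (is_derive_0_is_cst (f := fun s => (f s).2.2 ord0 j)) => x; have fx := fd x.
by der; rewrite /= mxE.
Qed.

(** The great circle motion of frequency [om] in the plane of [z] and [p],
    followed by the scalar rotation of angle [- k * t]. *)
Definition geo k om t lam : Phase R n :=
  (crot (- (k * t)) (cos (om * t) *: lam.1 - (om * sin (om * t)) *: lam.2),
   crot (- (k * t)) (cos (om * t) *: lam.2 + (sin (om * t) / om) *: lam.1)).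

Lemma geoK k om t lam : om != 0 -> geo k om t (geo k om (- t) lam) = lam.
Proof.
move=> om0; have cs := cos2Dsin2 (om * t).
rewrite /geo !mulrN opprK cosN sinN; apply: injective_projections => /=.
  rewrite -[RHS](crotNK (k * t)); congr crot.
  rewrite -!crotZ -crotN -!crotD; congr crot.
  by coords; [transitivity ((cos (om * t) ^+ 2 + sin (om * t) ^+ 2) * lam.1.1 ord0 j)
     |transitivity ((cos (om * t) ^+ 2 + sin (om * t) ^+ 2) * lam.1.2 ord0 j)];
     [field | rewrite cs mul1r | field | rewrite cs mul1r].
rewrite -[RHS](crotNK (k * t)); congr crot.
rewrite -!crotZ -!crotD; congr crot.
by coords; [transitivity ((cos (om * t) ^+ 2 + sin (om * t) ^+ 2) * lam.2.1 ord0 j)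
     |transitivity ((cos (om * t) ^+ 2 + sin (om * t) ^+ 2) * lam.2.2 ord0 j)];
     [field | rewrite cs mul1r | field | rewrite cs mul1r].
Qed.

Lemma flow_derive r hvec flow (t : R) x : 0 < r -> hamiltonian_field r hvec ->
  is_flow (cotangent r) hvec flow -> cotangent r x ->
  is_derive t 1 (flow ^~ x) (ham_field r (flow t x)).
Proof.
move=> r0 hh hf Mx; have [_ /(_ t) [Mt]] := hf x Mx.
by rewrite (hamiltonian_fieldE r0 hh Mt).
Qed.

Lemma is_derive_cst_R (f : R -> R) : (forall t : R, is_derive t 1 f 0) -> forall t, f t = f 0.
Proof. by move=> fd t; apply: is_derive_0_is_cst. Qed.

(** Scalar rotations preserve the Hamiltonian, so their momentum is conserved. *)
Lemma momentum_flow r hvec flow x t : 0 < r -> hamiltonian_field r hvec ->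
  is_flow (cotangent r) hvec flow -> cotangent r x ->
  momentum r (flow t x) = momentum r x.
Proof.
move=> r0 hh hf Mx; have [f0 _] := hf x Mx; rewrite -[in RHS]f0.
apply: (is_derive_cst_R (f := fun t => momentum r (flow t x))) => {}t.
have yd := flow_derive t r0 hh hf Mx.
have [_ /(_ t) [[/= zz pz] _]] := hf x Mx.
rewrite {1}/momentum; der.
set y := flow t x; rewrite /ham_field /= !(dotE, mulIE) dot_mulI dot_mulIr -/y in pz *.
by rewrite dot_mulIr pz; ring.
Qed.

Lemma speed_flow r hvec flow x t : 0 < r -> hamiltonian_field r hvec ->
  is_flow (cotangent r) hvec flow -> cotangent r x ->
  dot (flow t x).1 (flow t x).1 = dot x.1 x.1.
Proof.
move=> r0 hh hf Mx; have [f0 _] := hf x Mx; rewrite -[in RHS]f0.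
apply: (is_derive_cst_R (f := fun t => dot (flow t x).1 (flow t x).1)) => {}t.
have yd := flow_derive t r0 hh hf Mx.
have [_ /(_ t) [[/= zz pz] _]] := hf x Mx.
der; rewrite (dotC _ (flow t x).1) /ham_field /= !dotE dot_mulIr pz; ring.
Qed.

(** Both [momentum] and the norm of the covector being conserved, Hamilton's
    equations become linear with constant coefficients along an extremal;
    undoing [geo] along it then gives a curve with zero derivative. *)
Lemma flowE r hvec flow x t om : 0 < r -> hamiltonian_field r hvec ->
  is_flow (cotangent r) hvec flow -> cotangent r x ->
  om != 0 -> om ^+ 2 = dot x.1 x.1 / r ^+ 2 ->
  flow t x = geo (momentum r x) om t x.
Proof.
move=> r0 hh hf Mx om0 omE; set k := momentum r x.
suff H s : geo k om (- s) (flow s x) = x by rewrite -[in RHS](H t) geoK.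
transitivity (geo k om (- 0) (flow 0 x)); last first.
  have [-> _] := hf x Mx.
  by rewrite /geo !mulrN !mulr0 !oppr0 !crot0 cos0 sin0 mul0r mulr0 !scale0r !scale1r subr0 addr0 -surjective_pairing.
apply: (is_derive_0_cst (f := fun s => geo k om (- s) (flow s x))) => {}s.
have := flow_derive s r0 hh hf Mx.
rewrite /ham_field (momentum_flow s r0 hh hf Mx) (speed_flow s r0 hh hf Mx) -omE -/k => yd.
have e : (0 : Phase R n) = (crot (- (k * - s)) 0, crot (- (k * - s)) 0).
  by apply: injective_projections; rewrite -(scale0r (0 : CC R n)) crotZ !scale0r.
rewrite e /geo; apply: der_pair.
  eapply is_derive_eq; [eapply der_crot; repeat der1 | cbv beta].
  by congr crot; coords; field.
eapply is_derive_eq; [eapply der_crot; repeat der1 | cbv beta].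
by congr crot; coords; field.
Qed.

End flow.

(** * The Jacobi curve *)

Section jacobi.
Context {R : realType} {n : nat}.
Implicit Types (X Y z p u v w : CC R n) (lam xi eta x : Phase R n) (r k om t : R).
Implicit Types (hvec : Phase R n -> Phase R n) (flow : R -> Phase R n -> Phase R n).

(** On the unit level [|p|^2 = 1 + k^2 r^2], so the great circle motion has
    frequency [|p| / r = frequency r k]. *)
Definition frequency r k : R := Num.sqrt ((r ^+ 2)^-1 + k ^+ 2).

Lemma frequency_gt0 r k : 0 < r -> 0 < frequency r k.
Proof. by move=> r0; rewrite sqrtr_gt0 ltr_wpDr ?sqr_ge0 // invr_gt0 exprn_gt0. Qed.

Lemma frequency2 r k : frequency r k ^+ 2 = (r ^+ 2)^-1 + k ^+ 2.
Proof. by rewrite sqr_sqrtr // addr_ge0 ?sqr_ge0 // invr_ge0 sqr_ge0. Qed.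

Definition velocity r lam : CC R n := (ham_field r lam).2.

Lemma unit_level_dots r lam : 0 < r -> unit_level r lam ->
  let w := velocity r lam in let z := lam.2 in
  [/\ dot z z = r ^+ 2, dot z w = 0, dot (mulI z) w = 0 & dot w w = 1] /\
  dot lam.1 lam.1 / r ^+ 2 = frequency r (momentum r lam) ^+ 2.
Proof.
move=> r0 [[/= zz pz] E]; have rn0 : r != 0 by rewrite gt_eqF.
rewrite /sphere /= in zz.
have pp : dot lam.1 lam.1 = 1 + momentum r lam ^+ 2 * r ^+ 2.
  move: E; rewrite energyE zz pz /momentum => E.
  have -> : dot lam.1 lam.1 = 2 * (2^-1 * (dot lam.1 lam.1 - 0 ^+ 2 / r ^+ 2 -
    dot lam.1 (mulI lam.2) ^+ 2 / r ^+ 2)) + dot lam.1 (mulI lam.2) ^+ 2 / r ^+ 2 by field.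
  by rewrite E; field.
split; last by rewrite pp frequency2; field.
rewrite /velocity /ham_field /= !dotE dot_mulI (dot_mulIr lam.2) zz (dotC lam.2) pz (dotC (mulI lam.2)) pp.
by rewrite /momentum; split; [by []|ring|field|field].
Qed.

Lemma tangent_unit_level r lam xi : 0 < r -> unit_level r lam ->
  tangent (unit_level r) lam xi ->
  [/\ dot lam.2 xi.2 = 0, dot xi.1 lam.2 + dot lam.1 xi.2 = 0 &
   dot lam.1 xi.1 - momentum r lam * (dot xi.1 (mulI lam.2) + dot lam.1 (mulI xi.2)) = 0].
Proof.
move=> r0 Ml [c [Mc c0 cd]]; have rn0 : r != 0 by rewrite gt_eqF.
have [h1 h2] : dot lam.2 xi.2 = 0 /\ dot xi.1 lam.2 + dot lam.1 xi.2 = 0.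
  apply: (@tangent_cotangent _ _ r); exists c; split=> //.
  by apply: filterS Mc => s [].
split=> //.
have [[/= zz pz] _] := Ml; rewrite /sphere /= in zz.
suff H : is_derive (0 : R) 1 (fun s => energy (c s)) (dot lam.1 xi.1 - momentum r lam *
    (dot xi.1 (mulI lam.2) + dot lam.1 (mulI xi.2))).
  have K : \forall s \near (0 : R), energy (c s) = 2^-1 by apply: filterS Mc => s [].
  exact: (near_cst_derive K H).
have -> : (fun s => energy (c s)) = fun s =>
  2^-1 * (dot (c s).1 (c s).1 - dot (c s).1 (c s).2 ^+ 2 / dot (c s).2 (c s).2
          - dot (c s).1 (mulI (c s).2) ^+ 2 / dot (c s).2 (c s).2).
  by apply/funext => s; rewrite energyE.
der; rewrite c0 zz ?sqrf_eq0 // pz (dotC xi.2) h1 (dotC xi.1 lam.1) /momentum.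
by field.
Qed.

(** Moving the covector changes the momentum, at the rate [dk], and thereby the
    frequency, at the rate [dom], from [om ^+ 2 = 1 / r ^+ 2 + k ^+ 2]. *)
Lemma geo_vertical_derive r (c : R -> Phase R n) t v om k :
  0 < r -> om = frequency r k ->
  is_derive (0 : R) 1 c (v, 0) -> momentum r (c 0) = k ->
  let lam := c 0 in
  let dk := dot v (mulI lam.2) / r ^+ 2 in let dom := k * dk / om in
  let d1 : CC R n := cos (om * t) *: v
       + (dom * (sin (om * t) + om * t * cos (om * t))) *: lam.2
       - (dom * t * sin (om * t)) *: lam.1
       + (t * dk) *: mulI (cos (om * t) *: lam.1 + (om * sin (om * t)) *: lam.2) in
  let d2 : CC R n := - (sin (om * t) / om) *: v - (t * dom * sin (om * t)) *: lam.2
       - ((t * dom * cos (om * t)) / om - sin (om * t) * dom / om ^+ 2) *: lam.1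
       + (t * dk) *: mulI (cos (om * t) *: lam.2 - (sin (om * t) / om) *: lam.1) in
  is_derive (0 : R) 1
    (fun s => geo (momentum r (c s)) (frequency r (momentum r (c s))) (- t) (c s))
    (crot (k * t) d1, crot (k * t) d2).
Proof.
move=> r0 omE cd k0 /=; have rn0 : r != 0 by rewrite gt_eqF.
set dk := dot v _ / _.
have kd : is_derive (0 : R) 1 (fun s => momentum r (c s)) dk.
  by rewrite /momentum; der; rewrite /= mulI0 dot0r addr0 /dk; ring.
have om0 : 0 < om by rewrite omE frequency_gt0.
have omn0 : om != 0 by rewrite gt_eqF.
have od : is_derive (0 : R) 1 (fun s => frequency r (momentum r (c s))) (k * dk / om).
  rewrite /frequency; der; first by rewrite -sqrtr_gt0; exact: frequency_gt0.
  rewrite k0 -/(frequency r k) -omE expr1; field.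
  done.
rewrite /geo; apply: der_pair.
  eapply is_derive_eq; [eapply der_crot; repeat der1 | cbv beta].
  rewrite k0 -omE !mulrN cosN sinN opprK; congr crot; coords; field; done.
eapply is_derive_eq; [eapply der_crot; repeat der1 | cbv beta].
  by rewrite k0 -omE.
rewrite k0 -omE !mulrN cosN sinN opprK; congr crot; coords; field; done.
Qed.

End jacobi.

Section model.
Context {R : realType} {n : nat}.
Implicit Types (X Y z p u v w : CC R n) (lam xi eta x F : Phase R n) (r k om t : R).
Implicit Types (hvec : Phase R n -> Phase R n) (flow : R -> Phase R n -> Phase R n).

(** The complex orthogonal complement of [z] and [w], where the third block of
    the frame lives. *)
Definition transverse z w u : Prop :=
  [/\ dot u z = 0, dot u (mulI z) = 0, dot u w = 0 & dot u (mulI w) = 0].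

(** The frame at time 0: [vec_a], [vec_b] and their symplectic duals [covec_a],
    [covec_b]. The factor [1 / 2] makes the derivative of the model through
    [vec_a] start at [vec_b], a unit vector. With [om ^+ 2 - k ^+ 2] for
    [1 / r ^+ 2], the radius disappears from the formulas. *)
Definition vec_a z : Phase R n := (2^-1 *: mulI z, 0).
Definition vec_b w : Phase R n := (mulI w, 0).
Definition covec_b k om z w : Phase R n :=
  (k *: w - (om ^+ 2 - k ^+ 2) *: mulI z, - mulI w).
Definition covec_a k om z w : Phase R n :=
  (- (2 * om ^+ 2) *: mulI w, (2 * k) *: w - (2 * (om ^+ 2 - k ^+ 2)) *: mulI z).
Definition ham_dir k om z w : Phase R n :=
  (- (om ^+ 2 - k ^+ 2) *: z - k *: mulI w, w).

(** The solutions of [a' = b], [b' = fb], [fb' = - F - 4 om^2 b] with the above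
    initial values, for a constant [F]: this will be [covec_a] or its
    representative modulo the Hamiltonian field. *)
Definition model_a k om z w F t : Phase R n :=
  vec_a z + (sin (2 * om * t) / (2 * om)) *: vec_b w
  + ((1 - cos (2 * om * t)) / (4 * om ^+ 2)) *: covec_b k om z w
  - ((t - sin (2 * om * t) / (2 * om)) / (4 * om ^+ 2)) *: F.
Definition model_b k om z w F t : Phase R n :=
  cos (2 * om * t) *: vec_b w + (sin (2 * om * t) / (2 * om)) *: covec_b k om z w
  - ((1 - cos (2 * om * t)) / (4 * om ^+ 2)) *: F.
Definition model_fb k om z w F t : Phase R n :=
  - (2 * om * sin (2 * om * t)) *: vec_b w + cos (2 * om * t) *: covec_b k om z w
  - (sin (2 * om * t) / (2 * om)) *: F.
(** The oscillation of frequency [om] starting at the vertical vector [u]. *)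
Definition model_c om u t : Phase R n :=
  cos (om * t) *: (u, 0) + (sin (om * t) / om) *: (0, - u).
Definition model_fc om u t : Phase R n :=
  - (om * sin (om * t)) *: (u, 0) + cos (om * t) *: (0, - u).

Lemma double_angle (x : R) :
  (cos (2 * x) = 1 - 2 * sin x ^+ 2) * (sin (2 * x) = 2 * sin x * cos x).
Proof.
have cs := cos2Dsin2 x.
rewrite mulr_natl cos_mulr2n sin_mulr2n; split; last by rewrite -mulr_natl; ring.
have -> : cos x ^+ 2 = 1 - sin x ^+ 2 by rewrite -cs; ring.
by rewrite -mulr_natl; ring.
Qed.

Lemma flow_unit_level r hvec flow t lam : 0 < r -> hamiltonian_field r hvec ->
  is_flow (cotangent r) hvec flow -> unit_level r lam ->
  flow t lam = geo (momentum r lam) (frequency r (momentum r lam)) t lam.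
Proof.
move=> r0 hh hf Ml; have [Mc _] := Ml; apply: (flowE _ r0 hh hf Mc).
  by rewrite gt_eqF // frequency_gt0.
by have [_ ->] := unit_level_dots r0 Ml.
Qed.

(** The Gram matrix of [z], [i z], [w], [i w] in the form of rewrite rules. *)
Lemma frame_dots a z w :
  [/\ dot z z = a, dot z w = 0, dot (mulI z) w = 0 & dot w w = 1] ->
  (dot z z = a) * (dot z (mulI z) = 0) * (dot z w = 0) * (dot z (mulI w) = 0)
  * (dot (mulI z) z = 0) * (dot (mulI z) (mulI z) = a) * (dot (mulI z) w = 0)
  * (dot (mulI z) (mulI w) = 0)
  * (dot w z = 0) * (dot w (mulI z) = 0) * (dot w w = 1) * (dot w (mulI w) = 0)
  * (dot (mulI w) z = 0) * (dot (mulI w) (mulI z) = 0) * (dot (mulI w) w = 0)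
  * (dot (mulI w) (mulI w) = 1).
Proof.
move=> [zz zw zJw ww]; have zJw' : dot z (mulI w) = 0.
  by apply/eqP; rewrite -oppr_eq0 -dot_mulIl zJw.
have wJz : dot w (mulI z) = 0 by rewrite dotC.
by rewrite !dot_mulI !dot_mulIl !dot_mulIr (dotC w z) zw zJw' wJz zz ww oppr0.
Qed.

(** Half of [al] is the rate of change of the momentum, [be] the component of [v]
    along [i w] at time [t]. Rewriting the vectors at time [t] in terms of those
    at time 0 turns the angle [om * t] of the great circle into the angle
    [2 * om * t] of [model_a] and [model_b]. *)
Lemma geo_derivative_model k om t (al be : R) z w u : om != 0 ->
  let p := w + k *: mulI z in
  let F := covec_a k om z w in
  let zt := cos (om * t) *: z + (sin (om * t) / om) *: p in
  let pt := cos (om * t) *: p - (om * sin (om * t)) *: z in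
  let v := (al / 2) *: mulI zt + be *: mulI (pt - k *: mulI zt) + u in
  let dom := k * (al / 2) / om in
  let xi := al *: model_a k om z w F t + be *: model_b k om z w F t + model_c om u t in
  cos (om * t) *: v + (dom * (sin (om * t) + om * t * cos (om * t))) *: zt
       - (dom * t * sin (om * t)) *: pt
       + (t * (al / 2)) *: mulI (cos (om * t) *: pt + (om * sin (om * t)) *: zt) = xi.1
  /\ - (sin (om * t) / om) *: v - (t * dom * sin (om * t)) *: zt
       - ((t * dom * cos (om * t)) / om - sin (om * t) * dom / om ^+ 2) *: pt
       + (t * (al / 2)) *: mulI (cos (om * t) *: zt - (sin (om * t) / om) *: pt) = xi.2.
Proof.
move=> om0 p F zt pt v dom xi.
have cs : cos (om * t) ^+ 2 = 1 - sin (om * t) ^+ 2 by rewrite -(cos2Dsin2 (om * t)); ring.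
rewrite /xi /model_a /model_b /model_c -!(mulrA 2 om t) !double_angle /F /dom /v /zt /pt /p.
split; coords; field: cs; done.
Qed.

(** A vertical vector tangent to the unit level at time [t] is orthogonal to the
    velocity there; its components along [i z], [i w] and their complement,
    transported back to time 0, give the three terms. *)
Lemma jacobi_curve_model r hvec flow lam t xi :
  0 < r -> hamiltonian_field r hvec -> is_flow (cotangent r) hvec flow ->
  unit_level r lam -> jacobi_curve r flow lam t xi ->
  let k := momentum r lam in let om := frequency r k in
  let z := lam.2 in let w := velocity r lam in let F := covec_a k om z w in
  exists al bet u, transverse z w u /\
   xi = al *: model_a k om z w F t + bet *: model_b k om z w F t + model_c om u t.
Proof.
move=> r0 hh hf Ml [[v eta2] [teta eta20] [c [Mc c0 cd fcd]]].
move=> k om z w F; rewrite [eta2]eta20 {eta20} in teta cd.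
have om0 : om != 0 by rewrite gt_eqF // frequency_gt0.
have My : unit_level r (flow t lam) by rewrite -c0; exact: (nbhs_singleton Mc).
have [Mcl _] := Ml.
have ky : momentum r (flow t lam) = k by rewrite (momentum_flow t r0 hh hf Mcl).
have yE : flow t lam = geo k om t lam by exact: (flow_unit_level t r0 hh hf Ml).
set y := flow t lam in My ky yE teta c0 *.
have kc0 : momentum r (c 0) = k by rewrite c0.
have /= := geo_vertical_derive t r0 (erefl om) cd kc0.
set dk := dot v _ / _; set dom := k * dk / om.
move=> gd.
have : is_derive (0 : R) 1 (flow (- t) \o c)
   (crot (k * t) (cos (om * t) *: v
       + (dom * (sin (om * t) + om * t * cos (om * t))) *: y.2
       - (dom * t * sin (om * t)) *: y.1
       + (t * dk) *: mulI (cos (om * t) *: y.1 + (om * sin (om * t)) *: y.2)),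
   crot (k * t) (- (sin (om * t) / om) *: v - (t * dom * sin (om * t)) *: y.2
       - ((t * dom * cos (om * t)) / om - sin (om * t) * dom / om ^+ 2) *: y.1
       + (t * dk) *: mulI (cos (om * t) *: y.2 - (sin (om * t) / om) *: y.1))).
  rewrite c0 in gd; apply: near_eq_is_derive gd.
  apply: filterS Mc => s Ms /=.
  by rewrite (flow_unit_level (- t) r0 hh hf Ms).
move=> /(is_derive_unique fcd) ->.
have [_ tv tw] := tangent_unit_level r0 My teta.
rewrite /= dot0r addr0 in tv; rewrite /= mulI0 dot0r addr0 ky in tw.
have [/frame_dots fd _] := unit_level_dots r0 My.
have wE : velocity r y = y.1 - k *: mulI y.2 by rewrite /velocity /ham_field ky.
move: (velocity r y) fd wE => wy fd wE.
have p_y : y.1 = wy + k *: mulI y.2 by rewrite wE subrK.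
have rn0 : r != 0 by rewrite gt_eqF.
have vw : dot v wy = 0 by rewrite wE !dotE (dotC v y.1).
have lamE : lam = geo k om (- t) y by rewrite yE -{2}(opprK t) geoK.
pose bet := dot v (mulI wy).
pose u0 := v - dk *: mulI y.2 - bet *: mulI wy.
have dkE : dk * r ^+ 2 = dot v (mulI y.2) by rewrite /dk c0 divfK // sqrf_eq0.
have [q1 q2 q3 q4] : transverse y.2 wy u0.
  rewrite /u0; split; rewrite !dotE.
  - by rewrite tv !fd; ring.
  - by rewrite -dkE !fd; ring.
  - by rewrite vw !fd; ring.
  by rewrite -/bet !fd; ring.
have vE0 : v = dk *: mulI y.2 + bet *: mulI wy + u0 by rewrite /u0; coords; ring.
clearbody u0.
exists (2 * dk), bet, (crot (k * t) u0); split.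
  have zE : z = crot (k * t) (cos (om * t) *: y.2 - (sin (om * t) / om) *: (wy + k *: mulI y.2)).
    by rewrite -p_y /z lamE /geo /= !mulrN opprK cosN sinN mulNr scaleNr.
  have pE : lam.1 = crot (k * t) (cos (om * t) *: (wy + k *: mulI y.2) + (om * sin (om * t)) *: y.2).
    by rewrite -p_y lamE /geo /= !mulrN opprK cosN sinN mulrN scaleNr opprK.
  have -> : w = lam.1 - k *: mulI z by [].
  rewrite pE zE -!crotI -!crotZ -!crotN -!crotD.
  by split; rewrite -?crotI dot_crot !(dotE, mulIE) ?(q1, q2, q3, q4); ring.
have pE : lam.1 = w + k *: mulI z by rewrite /w /velocity /ham_field /= subrK.
have [] := geo_derivative_model k t (2 * dk) bet z w (crot (k * t) u0) om0.
have -> : 2 * dk / 2 = dk by field.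
rewrite -pE -/F => E1 E2.
have DA X Y : Y = crot (- (k * t)) X -> crot (k * t) Y = X by move=> ->; rewrite crotK.
have y2E : y.2 = crot (- (k * t)) (cos (om * t) *: z + (sin (om * t) / om) *: lam.1).
  by rewrite yE.
have y1E : y.1 = crot (- (k * t)) (cos (om * t) *: lam.1 - (om * sin (om * t)) *: z).
  by rewrite yE.
have vE : v = dk *: mulI y.2 + bet *: mulI (y.1 - k *: mulI y.2) + crot (- (k * t)) (crot (k * t) u0).
  by rewrite crotNK -wE.
apply: injective_projections.
  by rewrite -E1 [LHS]/=; apply: DA; rewrite vE y2E y1E; rewrite /dom; coords; ring.
by rewrite -E2 [LHS]/=; apply: DA; rewrite vE y2E y1E; rewrite /dom; coords; ring.
Qed.

End model.

(** * Rigidity of normal frames *)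

Section rigidity.
Context {R : realType} {n m : nat}.
Local Notation V := (Phase R n).

Lemma der_cst_pairing (X Y : R -> V) (k t : R) dX dY :
  (forall s, pairing (X s) (Y s) = k) ->
  is_derive t 1 X dX -> is_derive t 1 Y dY ->
  pairing dX (Y t) + pairing (X t) dY = 0.
Proof.
move=> H hX hY; have HH := der_pairing hX hY.
by apply: near_cst_derive HH; apply: filterE => s; exact: H.
Qed.

(** Unlike the frame of the theorem, a model frame has a third block indexed by
    all vectors [u] of the Euclidean space [C], with [e u] dual to [f u] up to the
    metric: no orthonormal basis of [C] has to be chosen, and a change of [Ec]
    becomes a change of index. *)
Record model_frame (om : R) (C : CC R n -> Prop) (ea eb fb : R -> V) (fa : V)
    (e f : CC R n -> R -> V) : Prop := ModelFrame {
  ea_derive : forall t : R, is_derive t 1 ea (eb t);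
  eb_derive : forall t : R, is_derive t 1 eb (fb t);
  fb_derive : forall t : R, is_derive t 1 fb (- fa - (4 * om ^+ 2) *: eb t);
  e_derive : forall u (t : R), is_derive t 1 (e u) (f u t);
  f_derive : forall u (t : R), is_derive t 1 (f u) (- om ^+ 2 *: e u t);
  pairing_ab : forall t : R,
    [/\ pairing (ea t) (eb t) = 0, pairing (ea t) fa = 1,
        pairing (ea t) (fb t) = 0, pairing (eb t) fa = 0 &
        pairing (eb t) (fb t) = 1];
  pairing_fafb : forall t : R, pairing fa (fb t) = 0;
  pairing_abc : forall u (t : R), C u ->
    [/\ pairing (ea t) (e u t) = 0, pairing (ea t) (f u t) = 0,
        pairing (eb t) (e u t) = 0 & pairing (eb t) (f u t) = 0];
  pairing_dual_c : forall u (t : R), C u ->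
    pairing fa (e u t) = 0 /\ pairing (fb t) (e u t) = 0;
  pairing_cc : forall u v (t : R), C u -> C v ->
    pairing (e u t) (e v t) = 0 /\ pairing (e u t) (f v t) = dot u v;
  e_zero : forall t, e 0 t = 0
}.

Definition model_space (C : CC R n -> Prop) (ea eb : R -> V)
    (e : CC R n -> R -> V) (t : R) (x : V) : Prop :=
  exists al be u, C u /\ x = al *: ea t + be *: eb t + e u t.

(** A normal frame, with exact instead of modular derivatives, of a curve of
    subspaces contained in [S]. *)
Record darboux_frame (S : R -> V -> Prop) (Ea Eb Fa Fb : R -> V)
    (Ec Fc : 'I_m -> R -> V) (Raa Rbb : R -> R) (Rac Rbc : R -> 'I_m -> R)
    (Rcc : R -> 'I_m -> 'I_m -> R) : Prop := DarbouxFrame {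
  Ea_derive : forall t : R, is_derive t 1 Ea (Eb t);
  Eb_derive : forall t : R, is_derive t 1 Eb (Fb t);
  Ec_derive : forall j (t : R), is_derive t 1 (Ec j) (Fc j t);
  Fa_derive : forall t : R, is_derive t 1 Fa
    (- (Raa t *: Ea t) - \sum_i Rac t i *: Ec i t);
  Fb_derive : forall t : R, is_derive t 1 Fb
    (- Fa t - Rbb t *: Eb t - \sum_i Rbc t i *: Ec i t);
  Fc_derive : forall j (t : R), is_derive t 1 (Fc j)
    (- (Rac t j *: Ea t) - Rbc t j *: Eb t - \sum_i Rcc t i j *: Ec i t);
  Ea_model : forall t, S t (Ea t);
  Eb_model : forall t, S t (Eb t);
  Ec_model : forall j t, S t (Ec j t);
  pairing_EabFab : forall t,
    [/\ pairing (Ea t) (Fa t) = 1, pairing (Ea t) (Fb t) = 0,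
        pairing (Eb t) (Fa t) = 0 & pairing (Eb t) (Fb t) = 1];
  pairing_FaFb : forall t, pairing (Fa t) (Fb t) = 0;
  pairing_EF : forall j t,
    [/\ pairing (Ec j t) (Fa t) = 0, pairing (Ec j t) (Fb t) = 0,
        pairing (Ea t) (Fc j t) = 0 & pairing (Eb t) (Fc j t) = 0];
  pairing_FcFab : forall j t,
    pairing (Fc j t) (Fa t) = 0 /\ pairing (Fc j t) (Fb t) = 0;
  pairing_EcFc : forall i j t, pairing (Ec i t) (Fc j t) = (i == j)%:R
}.

Variables (om : R) (C : CC R n -> Prop) (ea eb fb : R -> V) (fa : V).
Variables (e f : CC R n -> R -> V).
Hypothesis M : model_frame om C ea eb fb fa e f.
Local Notation S := (model_space C ea eb e).

Variables (Ea Eb Fa Fb : R -> V) (Ec Fc : 'I_m -> R -> V) (Raa Rbb : R -> R).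
Variables (Rac Rbc : R -> 'I_m -> R) (Rcc : R -> 'I_m -> 'I_m -> R).
Hypothesis N : darboux_frame S Ea Eb Fa Fb Ec Fc Raa Rbb Rac Rbc Rcc.

Lemma pairing_model_E t x : S t x ->
  [/\ pairing x (ea t) = 0, pairing x (eb t) = 0 & forall u, C u -> pairing x (e u t) = 0].
Proof.
move=> [al [be [u [Cu ->]]]]; have [p1 p2 p3 p4 p5] := pairing_ab M t.
have [q1 q2 q3 q4] := pairing_abc M t Cu.
split=> [||v Cv]; rewrite !pairingE.
- by rewrite pairing_self (pairingC (ea t) (eb t)) (pairingC (ea t) (e u t)) p1 q1; ring.
- by rewrite p1 pairing_self (pairingC (eb t) (e u t)) q3; ring.
have [-> _ -> _] := pairing_abc M t Cv; have [-> _] := pairing_cc M t Cu Cv; ring.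
Qed.

Lemma model_coords t x : S t x -> exists y, C y /\
  [/\ x = pairing x fa *: ea t + pairing x (fb t) *: eb t + e y t &
  forall u, C u -> pairing x (f u t) = dot y u].
Proof.
move=> [al [be [u [Cu xE]]]]; have [p1 p2 p3 p4 p5] := pairing_ab M t.
have [q1 q2 q3 q4] := pairing_abc M t Cu; have [r1 r2] := pairing_dual_c M t Cu.
exists u; split=> //; split.
  rewrite {2 3}xE !pairingE p2 p3 p4 p5 (pairingC _ (e u t)).
  by rewrite (pairingC (fb t)) r1 r2 !(mulr0,mulr1,addr0,add0r,oppr0) {1}xE.
move=> v Cv; rewrite xE !pairingE.
have [_ -> _ ->] := pairing_abc M t Cv; have [_ ->] := pairing_cc M t Cu Cv; ring.
Qed.

(** [Ea] and [Eb] lie in the isotropic span of [ea], [eb] and the [e u], so that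
    the derivative of [pairing Ea eb = 0] is [pairing Ea fb = 0]. *)
Lemma pairing_Ea_fb t : pairing (Ea t) (fb t) = 0.
Proof.
have H s : pairing (Ea s) (eb s) = 0 by case: (pairing_model_E (Ea_model N s)).
have := der_cst_pairing H (Ea_derive N t) (eb_derive M t).
by have [_ -> _] := pairing_model_E (Eb_model N t); rewrite add0r.
Qed.

Lemma pairing_Ea_f t u : C u -> pairing (Ea t) (f u t) = 0.
Proof.
move=> Cu.
have H s : pairing (Ea s) (e u s) = 0 by case: (pairing_model_E (Ea_model N s)) => _ _; apply.
have := der_cst_pairing H (Ea_derive N t) (e_derive M u t).
by have [_ _ ->] := pairing_model_E (Eb_model N t); rewrite ?add0r.
Qed.

(* The factor between the two frames, shown below to be a constant sign. *)
Let sgn t := pairing (Ea t) fa.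

Lemma Ea_proportional t : Ea t = sgn t *: ea t.
Proof.
have [y [Cy [H yE]]] := model_coords (Ea_model N t).
rewrite {1}H; suff -> : y = 0 by rewrite (e_zero M) addr0 pairing_Ea_fb scale0r addr0.
by apply: dot_eq0; rewrite -(yE _ Cy); exact: pairing_Ea_f.
Qed.

Lemma pairing_Eb_fb t : pairing (Eb t) (fb t) = sgn t.
Proof.
have := der_cst_pairing pairing_Ea_fb (Ea_derive N t) (fb_derive M t).
rewrite !pairingE; have [_ -> _] := pairing_model_E (Ea_model N t).
by rewrite mulr0 subr0 => /eqP; rewrite subr_eq0 => /eqP.
Qed.

Lemma Eb_decomposition t : Eb t = pairing (Eb t) fa *: ea t + sgn t *: eb t.
Proof.
have [y [Cy [H yE]]] := model_coords (Eb_model N t).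
rewrite {1}H pairing_Eb_fb; suff -> : y = 0 by rewrite (e_zero M) addr0.
apply: dot_eq0; rewrite -yE //.
have H1 s : pairing (Ea s) (f y s) = 0 by exact: pairing_Ea_f.
have := der_cst_pairing H1 (Ea_derive N t) (f_derive M y t).
by rewrite pairingZr; have [_ _ -> //] := pairing_model_E (Ea_model N t); rewrite mulr0 addr0.
Qed.

(** The normalization [pairing Eb Fb = 1], with [Fb = Eb'], fixes the sign only. *)
Lemma sign_sqr t : sgn t ^+ 2 = 1.
Proof.
have H1 s : pairing (Eb s) (eb s) = 0 by case: (pairing_model_E (Eb_model N s)).
have H2 s : pairing (Eb s) (ea s) = 0 by case: (pairing_model_E (Eb_model N s)).
have := der_cst_pairing H1 (Eb_derive N t) (eb_derive M t); rewrite pairing_Eb_fb => K1.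
have := der_cst_pairing H2 (Eb_derive N t) (ea_derive M t); rewrite H1 addr0 => K2.
have [_ _ _] := pairing_EabFab N t; rewrite Eb_decomposition !pairingE.
rewrite (pairingC (Fb t)) K2 oppr0 mulr0 add0r (pairingC (Fb t)) => <-.
by rewrite expr2; congr (_ * _); apply/eqP; rewrite -addr_eq0 addrC; apply/eqP.
Qed.

Lemma sign_constant t : sgn t = sgn 0.
Proof.
apply: is_derive_0_is_cst => {}t.
have ald : is_derive t 1 sgn (pairing (Eb t) fa).
  have := der_pairing (Ea_derive N t) (is_derive_cst fa t 1).
  by rewrite pairing0r addr0.
suff <- : pairing (Eb t) fa = 0 by [].
have H : is_derive t 1 (fun s => sgn s ^+ 2) (2 * sgn t * pairing (Eb t) fa).
  by der; rewrite expr1.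
have : 2 * sgn t * pairing (Eb t) fa = 0.
  exact: (near_cst_derive (filterE _ sign_sqr) H).
move/eqP; rewrite mulf_eq0 mulf_eq0 pnatr_eq0 /= => /orP[/eqP s0|/eqP //].
by have /eqP := sign_sqr t; rewrite s0 expr0n eq_sym oner_eq0.
Qed.

Let sgn0 := sgn 0.
Lemma sgn0_sqr : sgn0 ^+ 2 = 1. Proof. exact: sign_sqr. Qed.
Lemma sgn0_mul : sgn0 * sgn0 = 1. Proof. by rewrite -expr2 sgn0_sqr. Qed.

Lemma EaE : Ea = fun t => sgn0 *: ea t.
Proof. by apply/funext => t; rewrite Ea_proportional sign_constant. Qed.

Lemma EbE : Eb = fun t => sgn0 *: eb t.
Proof.
apply/funext => t; have := Ea_derive N t; rewrite EaE => H.
exact: (is_derive_unique H (derZr sgn0 (ea_derive M t))).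
Qed.

Lemma FbE : Fb = fun t => sgn0 *: fb t.
Proof.
apply/funext => t; have := Eb_derive N t; rewrite EbE => H.
exact: (is_derive_unique H (derZr sgn0 (eb_derive M t))).
Qed.

(** Comparing two expressions of [Fb']: from this equation, pairings with the
    given frame extract [Rbb], [Rbc] and [Fa]. *)
Lemma Fb_derive_eq t : - Fa t - Rbb t *: Eb t - \sum_i Rbc t i *: Ec i t =
  sgn0 *: (- fa - (4 * om ^+ 2) *: eb t).
Proof.
have := Fb_derive N t; rewrite FbE => H.
exact: (is_derive_unique H (derZr sgn0 (fb_derive M t))).
Qed.

Lemma ebE t : eb t = sgn0 *: Eb t.
Proof. by rewrite EbE scalerA sgn0_mul scale1r. Qed.

Lemma pairing_Ec_E j t k : pairing (Ec j t) (Ea t) = 0 /\ pairing (Ec j t) (Eb t) = 0 /\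
   pairing (Ec j t) (Ec k t) = 0.
Proof.
have [h1 h2 h3] := pairing_model_E (Ec_model N j t).
rewrite EaE EbE !pairingE h1 h2 mulr0; split=> //; split => //.
have [al' [be [u [Cu ->]]]] := Ec_model N k t.
by rewrite !pairingE h1 h2 h3 // !mulr0 !addr0.
Qed.

Lemma faE t : fa = sgn0 *: (Fa t + Rbb t *: Eb t + \sum_i Rbc t i *: Ec i t)
   - (4 * om ^+ 2) *: eb t.
Proof.
have -> : Fa t + Rbb t *: Eb t + \sum_i Rbc t i *: Ec i t =
  - (sgn0 *: (- fa - (4 * om ^+ 2) *: eb t)) by rewrite -Fb_derive_eq !opprD !opprK.
by rewrite scalerN scalerA sgn0_mul scale1r opprD !opprK addrK.
Qed.

(** [Ec] pairs to zero with [fb] and [fa], as these are combinations of [Fa], [Fb]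
    and of vectors of the isotropic span of the given frame. *)
Lemma Ec_model_eq j t : exists y, C y /\ Ec j t = e y t /\
   forall u, C u -> pairing (Ec j t) (f u t) = dot y u.
Proof.
have [y [Cy [H yE]]] := model_coords (Ec_model N j t).
exists y; split=> //; split=> //.
rewrite {1}H; have [d1 d2 _ _] := pairing_EF N j t; have [g1 [g2 _]] := pairing_Ec_E j t j.
have -> : pairing (Ec j t) (fb t) = 0.
  by have := d2; rewrite FbE pairingZr => /eqP; rewrite mulf_eq0 => /orP[/eqP a00|/eqP //];
   have := sgn0_mul; rewrite a00 mul0r => /eqP; rewrite eq_sym oner_eq0.
have -> : pairing (Ec j t) fa = 0.
  rewrite (faE t) ebE !pairingE d1 g2 pairing_sumr big1 => [|i _]; first by ring.
  by have [_ [_ h]] := pairing_Ec_E j t i; rewrite pairingZr h mulr0.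
by rewrite !scale0r !add0r.
Qed.

Lemma pairing_Fc_fa i t : pairing (Fc i t) fa = 0.
Proof.
have H s : pairing (Ec i s) fa = 0.
  have [y [Cy [-> _]]] := Ec_model_eq i s.
  by have [h _] := pairing_dual_c M s Cy; rewrite pairingC h oppr0.
by have := der_cst_pairing H (Ec_derive N i t) (is_derive_cst fa t 1); rewrite pairing0r addr0.
Qed.

Lemma pairing_Fc_dFb i t : pairing (Fc i t) (- Fa t - Rbb t *: Eb t - \sum_i Rbc t i *: Ec i t) =
   Rbc t i.
Proof.
rewrite !pairingE; have [-> _] := pairing_FcFab N i t; have [_ _ _ h] := pairing_EF N i t.
rewrite (pairingC (Eb t)) h pairing_sumr (bigD1 i) //= big1 => [|k ki].
  by rewrite pairingZr (pairingC (Ec i t)) (pairing_EcFc N) eqxx mulr1n; ring.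
by rewrite pairingZr (pairingC (Ec k t)) (pairing_EcFc N) (negPf ki) mulr0n; ring.
Qed.

Lemma Rbc0 t i : Rbc t i = 0.
Proof.
rewrite -(pairing_Fc_dFb i t) Fb_derive_eq ebE !pairingE pairing_Fc_fa (pairingC (Eb t)).
by have [_ _ _ ->] := pairing_EF N i t; ring.
Qed.

Lemma RbbE t : Rbb t = 4 * om ^+ 2.
Proof.
have : pairing (Fb t) (- Fa t - Rbb t *: Eb t - \sum_i Rbc t i *: Ec i t) =
  pairing (Fb t) (sgn0 *: (- fa - (4 * om ^+ 2) *: eb t)) by rewrite Fb_derive_eq.
have [_ _ _ p5] := pairing_ab M t; have [_ _ _ d4] := pairing_EabFab N t.
rewrite big1 => [|i _]; last by rewrite Rbc0 scale0r.
rewrite !pairingE (pairingC (Fa t)) (pairing_FaFb N) (pairingC (Eb t)) d4 FbE !pairingE.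
rewrite (pairingC fa) (pairing_fafb M) (pairingC (eb t)).
have [_ _ _ _ ->] := pairing_ab M t => H.
transitivity (sgn0 * sgn0 * (4 * om ^+ 2)); last by rewrite sgn0_mul mul1r.
by rewrite -[LHS]/(Rbb t); move: H; lra.
Qed.

Lemma FaE : Fa = fun=> sgn0 *: fa.
Proof.
apply/funext => t; have := Fb_derive_eq t; rewrite RbbE EbE.
rewrite big1 => [|i _]; last by rewrite Rbc0 scale0r.
rewrite subr0 scalerBr !scalerA [sgn0 * _]mulrC => /addIr.
by rewrite scalerN => /oppr_inj.
Qed.

Lemma Fa_derive_eq t : - (Raa t *: Ea t) - \sum_i Rac t i *: Ec i t = 0.
Proof.
have := Fa_derive N t; rewrite FaE => H.
by have := is_derive_unique H (derZr sgn0 (is_derive_cst fa t 1)); rewrite scaler0.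
Qed.

Lemma Raa0 t : Raa t = 0.
Proof.
have := congr1 (fun x => pairing x (Fa t)) (Fa_derive_eq t); rewrite !pairingE pairing_suml big1 => [|i _].
  by have [-> _ _ _] := pairing_EabFab N t; lra.
by rewrite pairingZl; have [-> _ _ _] := pairing_EF N i t; rewrite mulr0.
Qed.

Lemma Rac0 t i : Rac t i = 0.
Proof.
have := congr1 (fun x => pairing x (Fc i t)) (Fa_derive_eq t); rewrite !pairingE pairing_suml (bigD1 i) //= big1 => [|k ki].
  by rewrite pairingZl (pairing_EcFc N) eqxx mulr1n; have [_ _ -> _] := pairing_EF N i t; lra.
by rewrite pairingZl (pairing_EcFc N) (negPf ki) mulr0n mulr0.
Qed.

Lemma Fc_derive_eq j t : - (Rac t j *: Ea t) - Rbc t j *: Eb t - \sum_i Rcc t i j *: Ec i t =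
   - \sum_i Rcc t i j *: Ec i t.
Proof. by rewrite Rac0 Rbc0 !scale0r oppr0 !add0r. Qed.

Lemma pairing_Ec_e j t u : C u -> pairing (Ec j t) (e u t) = 0.
Proof. by move=> Cu; case: (pairing_model_E (Ec_model N j t)) => _ _; apply. Qed.

Lemma pairing_Fc_e j t u : C u -> pairing (Fc j t) (e u t) = - pairing (Ec j t) (f u t).
Proof.
move=> Cu; have H s := pairing_Ec_e j s Cu.
have := der_cst_pairing H (Ec_derive N j t) (e_derive M u t).
by move/eqP; rewrite addr_eq0 => /eqP.
Qed.

(** Differentiating [pairing Ec (e u) = 0] twice gives
    [2 * pairing Fc (f u) = 0], as [Fc'] lies in the span of the [Ec]. In terms of
    the index [y] of [Ec = e y], this says that [y' = 0]. *)
Lemma pairing_Fc_f j t u : C u -> pairing (Fc j t) (f u t) = 0.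
Proof.
move=> Cu.
have H s : pairing (Fc j s) (e u s) + pairing (Ec j s) (f u s) = 0.
  by rewrite pairing_Fc_e // addNr.
have D1 := der_pairing (Fc_derive N j t) (e_derive M u t).
have D2 := der_pairing (Ec_derive N j t) (f_derive M u t).
have := derD D1 D2.
move/(near_cst_derive (k := 0)) => /(_ (filterE _ H)).
rewrite Fc_derive_eq pairingNl pairing_suml big1 => [|i _]; last first.
  by rewrite pairingZl pairing_Ec_e // mulr0.
by rewrite pairingZr pairing_Ec_e //; lra.
Qed.

(** The derivative of [pairing Fc (f u) = 0]. *)
Lemma pairing_Rcc_f j t u : C u ->
  \sum_i Rcc t i j * pairing (Ec i t) (f u t) = om ^+ 2 * pairing (Ec j t) (f u t).
Proof.
move=> Cu; have H s := pairing_Fc_f j s Cu.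
have := der_cst_pairing H (Fc_derive N j t) (f_derive M u t).
rewrite Fc_derive_eq pairingNl pairing_suml pairingZr pairing_Fc_e //.
under eq_bigr do rewrite pairingZl.
by move=> K; move: K; lra.
Qed.

(** The normal frame is unique up to a common sign [a] of [(Ea, Eb)] and the
    choice of an orthonormal family [y]. *)
Theorem normal_frame_rigid t :
  [/\ Raa t = 0, Rbb t = 4 * om ^+ 2, forall i, Rac t i = 0, forall i, Rbc t i = 0 &
  exists a y, [/\ a ^+ 2 = 1, Ea t = a *: ea t, Eb t = a *: eb t &
   forall j, [/\ C (y j), Ec j t = e (y j) t, forall k, dot (y j) (y k) = (j == k)%:R &
     \sum_i Rcc t i j *: y i = om ^+ 2 *: y j]]].
Proof.
split; [exact: Raa0|exact: RbbE|exact: Rac0|exact: Rbc0|].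
exists sgn0; have [y yP] := choice (fun j => Ec_model_eq j t).
exists y; split; [exact: sgn0_sqr|by rewrite EaE|by rewrite EbE|move=> j].
have [Cy [yE yf]] := yP j; split=> // [k|].
  have [Cy' [yE' yf']] := yP k.
  rewrite -yf // -(opprK (pairing _ _)) -pairing_Fc_e // -yE' -pairingC (pairing_EcFc N).
  by rewrite eq_sym.
(* Both sides have the same products with the elements of [C], and their
   difference is a combination of such elements. *)
apply/eqP; rewrite -subr_eq0; apply/eqP; apply: dot_eq0.
set D := _ - _.
have DC u : C u -> dot u D = 0.
  move=> Cu; rewrite dotC /D dotDl dotNl dotZl dot_suml.
  rewrite (eq_bigr (fun i => Rcc t i j * pairing (Ec i t) (f u t))) => [|i _].
    by rewrite pairing_Rcc_f // yf // subrr.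
  by have [_ [_ h]] := yP i; rewrite dotZl -(h u Cu).
rewrite {1}/D dotDl dotNl dotZl dot_suml DC // mulr0 subr0 big1 // => i _.
by have [Ci _] := yP i; rewrite dotZl DC // mulr0.
Qed.

End rigidity.

(** * The explicit frame *)

Section explicit_frame.
Context {R : realType} {n : nat}.
Variables (k om : R) (z w : CC R n).
Hypothesis om0 : om != 0.
Hypothesis mz : (om ^+ 2 - k ^+ 2) * dot z z = 1.
Hypothesis zw : dot z w = 0.
Hypothesis zJw : dot (mulI z) w = 0.
Hypothesis ww : dot w w = 1.
Local Notation V := (Phase R n).

Let h := ham_dir k om z w.
(** The projection onto [dot w x.2 = 0] along the Hamiltonian direction [h]: it
    realizes the quotient by [h] as a subspace. *)
Definition reduce (x : V) : V := x - dot w x.2 *: h.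

(* The reduction of [covec_a]. It equals [- 2 / r ^+ 2] times the generator
   [(i p, i z)] of the scalar rotations. *)
Let F : V := covec_a k om z w - (2 * k) *: h.
Let A := vec_a z.
Let B := vec_b w.
Let G := covec_b k om z w.
Let fd := frame_dots (And4 (erefl (dot z z)) zw zJw ww).

Lemma reduceD x y : reduce (x + y) = reduce x + reduce y.
Proof. by rewrite /reduce /= dotDr scalerDl opprD addrACA. Qed.
Lemma reduceZ (a : R) x : reduce (a *: x) = a *: reduce x.
Proof. by rewrite /reduce /= dotZr scalerBr scalerA. Qed.
Lemma reduceN x : reduce (- x) = - reduce x.
Proof. by rewrite -scaleN1r reduceZ scaleN1r. Qed.
Lemma reduce0 : reduce 0 = 0.
Proof. by have := reduceZ 0 0; rewrite !scale0r. Qed.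
Lemma reduce_sum m (x : 'I_m -> V) : reduce (\sum_i x i) = \sum_i reduce (x i).
Proof. by elim/big_ind2 : _ => [|a b c d <- <-|//]; [exact: reduce0|exact: reduceD]. Qed.
Lemma reduce_h : reduce h = 0.
Proof. by rewrite /reduce /= ww scale1r subrr. Qed.

Lemma reduce_deriv_mod f t u : deriv_mod h f t u ->
  is_derive t 1 (fun s => reduce (f s)) (reduce u).
Proof.
move=> [a fd']; rewrite /reduce.
eapply is_derive_eq; [repeat der1 | cbv beta].
rewrite dot0l add0r -/(reduce (u + a *: h)) reduceD reduceZ reduce_h scaler0 addr0.
by [].
Qed.

(** Vectors tangent to the unit level pair to zero with [h]. *)
Lemma pairing_reduce x y : pairing h x = 0 -> pairing h y = 0 ->
  pairing (reduce x) (reduce y) = pairing x y.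
Proof.
move=> hx hy; rewrite /reduce !pairingE hy (pairingC h x) hx.
by rewrite pairing_self; ring.
Qed.

Lemma base_pairings :
  (pairing A B = 0) * (pairing A F = 1) * (pairing A G = 0)
 * (pairing B F = 0) * (pairing B G = 1) * (pairing F G = 0)
 * (pairing B A = 0) * (pairing F A = -1) * (pairing G A = 0)
 * (pairing F B = 0) * (pairing G B = -1) * (pairing G F = 0)
 * (pairing A A = 0) * (pairing B B = 0) * (pairing F F = 0) * (pairing G G = 0).
Proof.
have AB : pairing A B = 0 by rewrite /pairing /= !dotE subrr.
have AF : pairing A F = 1.
  by rewrite /pairing /= !dotE !fd -[RHS]mz; field.
have AG : pairing A G = 0 by rewrite /pairing /= !dotE !fd; ring.
have BF : pairing B F = 0 by rewrite /pairing /= !dotE !fd; ring.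
have BG : pairing B G = 1 by rewrite /pairing /= !dotE !fd; ring.
have FG : pairing F G = 0.
  transitivity (2 * (om ^+ 2 - k ^+ 2) * ((om ^+ 2 - k ^+ 2) * dot z z - 1)).
    by rewrite /pairing /= !dotE !fd; ring.
  by rewrite mz subrr mulr0.
have anti x y a : pairing x y = a -> pairing y x = - a by move=> <-; exact: pairingC.
do ![split]; rewrite ?pairing_self //; first [exact: anti | by rewrite -[RHS]oppr0; exact: anti].
Qed.

Lemma base_c u v : transverse z w u ->
  (pairing A (u, 0) = 0) * (pairing B (u, 0) = 0) * (pairing F (u, 0) = 0)
  * (pairing G (u, 0) = 0)
  * (pairing A (0, - u) = 0) * (pairing B (0, - u) = 0) * (pairing F (0, - u) = 0)
  * (pairing G (0, - u) = 0)
  * (pairing (u, 0) (v, 0) = 0) * (pairing (0, -u) (0, - v) = 0)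
  * (pairing (u, 0) (0, - v) = dot u v) * (pairing (0, - u) (v, 0) = - dot u v).
Proof.
move=> [u1 u2 u3 u4].
have u1' : dot z u = 0 by rewrite dotC.
have u2' : dot (mulI z) u = 0 by rewrite dotC.
have u3' : dot w u = 0 by rewrite dotC.
have u4' : dot (mulI w) u = 0 by rewrite dotC.
rewrite /pairing /=; rewrite !dotE ?(u1, u2, u3, u4, u1', u2', u3', u4') (dotC v u).
by do ![split]; ring.
Qed.

Lemma ham_dir_pairings u : transverse z w u ->
  (pairing h A = 0) * (pairing h B = 0) * (pairing h G = 0)
  * (pairing h (covec_a k om z w) = 0) * (pairing h (u, 0) = 0) * (pairing h (0, - u) = 0).
Proof.
move=> [u1 u2 u3 u4].
have u2' : dot (mulI z) u = 0 by rewrite dotC.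
have u1' : dot z u = 0 by rewrite dotC.
have u4' : dot (mulI w) u = 0 by rewrite dotC.
rewrite /pairing /= !dotE !fd ?(u1, u2, u3, u4, u2', u4', u1').
by do ![split]; ring.
Qed.

Lemma reduce_model u t al be : transverse z w u ->
  reduce (al *: model_a k om z w (covec_a k om z w) t
     + be *: model_b k om z w (covec_a k om z w) t + model_c om u t) =
  al *: model_a k om z w F t + be *: model_b k om z w F t + model_c om u t.
Proof.
move=> [u1 u2 u3 u4].
have rA : reduce A = A by rewrite /reduce /= dot0r scale0r subr0.
have rB : reduce B = B by rewrite /reduce /= dot0r scale0r subr0.
have rG : reduce G = G by rewrite /reduce /= dotNr fd oppr0 scale0r subr0.
have rF : reduce (covec_a k om z w) = F.
  by rewrite /reduce /= !dotE !fd mulr1 mulr0 subr0.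
have ru : reduce (u, 0) = (u, 0) by rewrite /reduce /= dot0r scale0r subr0.
have rv : reduce (0, - u) = (0, - u) by rewrite /reduce /= dotNr (dotC w) u3 oppr0 scale0r subr0.
rewrite /model_a /model_b /model_c -/A -/B -/G.
by rewrite !(reduceD, reduceZ, reduceN) rA rB rG rF ru rv.
Qed.

Lemma ham_dir_model u t al be : transverse z w u ->
  pairing h (al *: model_a k om z w (covec_a k om z w) t
     + be *: model_b k om z w (covec_a k om z w) t + model_c om u t) = 0.
Proof.
move=> Cu; rewrite /model_a /model_b /model_c -/A -/B -/G.
have H := ham_dir_pairings Cu.
by rewrite !pairingE !H; ring.
Qed.

Let ea := model_a k om z w F.
Let eb := model_b k om z w F.
Let fb := model_fb k om z w F.

Lemma model_a_derive (t : R) : is_derive t 1 ea (eb t).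
Proof.
rewrite /ea /eb /model_a /model_b; move: (vec_a _) (vec_b _) (covec_b _ _ _ _) F => ? ? ? ?.
der; apply: injective_projections; coords; field; done.
Qed.

Lemma model_b_derive (t : R) : is_derive t 1 eb (fb t).
Proof.
rewrite /eb /fb /model_b /model_fb; move: (vec_b _) (covec_b _ _ _ _) F => ? ? ?.
der; apply: injective_projections; coords; field; done.
Qed.

Lemma model_fb_derive (t : R) : is_derive t 1 fb (- F - (4 * om ^+ 2) *: eb t).
Proof.
rewrite /eb /fb /model_b /model_fb; move: (vec_b _) (covec_b _ _ _ _) F => ? ? ?.
der; apply: injective_projections; coords; field; done.
Qed.

Lemma model_c_derive (u : CC R n) (t : R) : is_derive t 1 (model_c om u) (model_fc om u t).
Proof.
rewrite /model_c /model_fc; der; apply: injective_projections; coords; field; done.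
Qed.

Lemma model_fc_derive (u : CC R n) (t : R) : is_derive t 1 (model_fc om u) (- om ^+ 2 *: model_c om u t).
Proof.
rewrite /model_c /model_fc; der; apply: injective_projections; coords; field; done.
Qed.

Lemma model_ab_pairings (t : R) :
  [/\ pairing (ea t) (eb t) = 0, pairing (ea t) F = 1, pairing (ea t) (fb t) = 0,
     pairing (eb t) F = 0 & pairing (eb t) (fb t) = 1].
Proof.
have cs : cos (2 * om * t) ^+ 2 = 1 - sin (2 * om * t) ^+ 2.
  by apply/eqP; rewrite eq_sym subr_eq cos2Dsin2.
rewrite /ea /eb /fb /model_a /model_b /model_fb -/A -/B -/G.
move: A B G F base_pairings => A' B' G' F' H.
by split; rewrite !pairingE !H; field: cs.
Qed.

Lemma pairing_F_fb t : pairing F (fb t) = 0.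
Proof.
rewrite /fb /model_fb -/B -/G; move: A B G F base_pairings => A' B' G' F' H.
by rewrite !pairingE !H; ring.
Qed.

Lemma model_abc_pairings u t : transverse z w u ->
  [/\ pairing (ea t) (model_c om u t) = 0, pairing (ea t) (model_fc om u t) = 0,
      pairing (eb t) (model_c om u t) = 0 & pairing (eb t) (model_fc om u t) = 0].
Proof.
move=> Cu; have H := base_c 0 Cu.
rewrite /ea /eb /model_a /model_b /model_c /model_fc -/A -/B -/G.
move: A B G F H => A' B' G' F' H.
by split; rewrite !pairingE !H; ring.
Qed.

Lemma model_cofactor_pairings u t : transverse z w u ->
  pairing F (model_c om u t) = 0 /\ pairing (fb t) (model_c om u t) = 0.
Proof.
move=> Cu; have H := base_c 0 Cu.
rewrite /fb /model_fb /model_c -/A -/B -/G.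
move: A B G F H => A' B' G' F' H.
by split; rewrite !pairingE !H; ring.
Qed.

Lemma model_cc_pairings u v t : transverse z w u -> transverse z w v ->
  pairing (model_c om u t) (model_c om v t) = 0 /\
  pairing (model_c om u t) (model_fc om v t) = dot u v.
Proof.
move=> Cu Cv; have H := base_c v Cu.
have cs : cos (om * t) ^+ 2 = 1 - sin (om * t) ^+ 2.
  by apply/eqP; rewrite eq_sym subr_eq cos2Dsin2.
rewrite /model_c /model_fc !pairingE !H.
by split; field: cs.
Qed.

Lemma model_c0 t : model_c om (0 : CC R n) t = 0.
Proof.
by rewrite /model_c; apply: injective_projections; coords; ring.
Qed.

Lemma explicit_model_frame :
  model_frame om (transverse z w) ea eb fb F (model_c om) (model_fc om).
Proof.
exact: (ModelFrame model_a_derive model_b_derive model_fb_derive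
  model_c_derive model_fc_derive model_ab_pairings pairing_F_fb
  (fun u t Cu => model_abc_pairings t Cu)
  (fun u t Cu => model_cofactor_pairings t Cu)
  (fun u v t Cu Cv => model_cc_pairings t Cu Cv) model_c0).
Qed.

End explicit_frame.

(** * The curvatures of the given frame *)

Section given_frame.
Context {R : realType} {n : nat}.
Implicit Types (r : R) (hvec : Phase R n -> Phase R n)
  (flow : R -> Phase R n -> Phase R n) (lam : Phase R n) (fr : moving_frame R n).

(** The hypotheses say that [x] is tangent to the unit level at
    [(w + k *: mulI z, z)], where [ham_dir] is the symplectic gradient of the
    energy. *)
Lemma ham_dir_level (k om : R) (z w : CC R n) (x : Phase R n) : dot z x.2 = 0 ->
  dot (w + k *: mulI z) x.1
   - k * (dot x.1 (mulI z) + dot (w + k *: mulI z) (mulI x.2)) = 0 ->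
  pairing (ham_dir k om z w) x = 0.
Proof.
rewrite !dotDl !dotZl dot_mulI (dotC _ (mulI z)) => t1; rewrite t1 => t3.
by rewrite /pairing /= !dotDl !dotNl !dotZl t1 dot_mulIl -[RHS]t3 (dotC w (mulI _)) (dotC w); ring.
Qed.

Lemma frame_tnth fr t :
  [/\ tnth (Eall fr t) ord0 = Ea fr t, tnth (Eall fr t) (lift ord0 ord0) = Eb fr t &
    forall j, tnth (Eall fr t) (lift ord0 (lift ord0 j)) = tnth (Ec fr t) j] /\
  [/\ tnth (Fall fr t) ord0 = Fa fr t, tnth (Fall fr t) (lift ord0 ord0) = Fb fr t &
    forall j, tnth (Fall fr t) (lift ord0 (lift ord0 j)) = tnth (Fc fr t) j].
Proof.
split; split=> [||j]; rewrite ?tnthS ?tnth0 //.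
Qed.

(** The reduced frame is a Darboux frame inside the model spaces. At time 0 the
    vectors [E] are vertical, hence equal to their reductions. *)
Lemma normal_frame_curvature r hvec flow lam fr :
  0 < r -> hamiltonian_field r hvec -> is_flow (cotangent r) hvec flow ->
  unit_level r lam -> normal_frame r hvec flow lam fr ->
  let w := velocity r lam in let om := frequency r (momentum r lam) in
  [/\ Raa fr 0 = 0, Rbb fr 0 = 4 * om ^+ 2, Rac fr 0 = 0, Rbc fr 0 = 0 &
  exists a y, [/\ a ^+ 2 = 1, Eb fr 0 = a *: to_vertical (mulI w) &
    forall j : 'I_(2 * n - 2), [/\ transverse lam.2 w (y j), tnth (Ec fr 0) j = to_vertical (y j),
       forall i, dot (y j) (y i) = (j == i)%:R &
       \sum_i Rcc fr 0 i j *: y i = om ^+ 2 *: y j]]].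
Proof.
move=> r0 hh hf Ml hfr w om.
pose k := momentum r lam; pose z := lam.2.
have [Mc _] := Ml.
have rn0 : r != 0 by rewrite gt_eqF.
have om0 : om != 0 by rewrite gt_eqF // frequency_gt0.
have [[zz zw zJw ww] _] := unit_level_dots r0 Ml.
have mz : (om ^+ 2 - k ^+ 2) * dot z z = 1.
  by rewrite frequency2 addrK zz mulVf // sqrf_eq0.
have pE : lam.1 = w + k *: mulI z by rewrite /w /velocity /ham_field /= subrK.
pose h := ham_dir k om z w.
have hE : hvec lam = h.
  rewrite (hamiltonian_fieldE r0 hh Mc); apply: injective_projections => //.
  rewrite /ham_field /h /ham_dir /=.
  have [_ ->] := unit_level_dots r0 Ml; rewrite -/k -/om.
  by rewrite -/k pE -/z; move: (w) => w'; coords; ring.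
pose q := @reduce R n k om z w.
pose F := covec_a k om z w - (2 * k) *: h.
pose S := model_space (transverse z w) (model_a k om z w F) (model_b k om z w F) (model_c om).
have jm t x : jacobi_curve r flow lam t x -> exists al be u, transverse z w u /\
   x = al *: model_a k om z w (covec_a k om z w) t +
       be *: model_b k om z w (covec_a k om z w) t + model_c om u t.
  by move=> /(jacobi_curve_model r0 hh hf Ml).
have hd t : [/\ forall j, S t (q (tnth (Eall fr t) j)),
     forall j, pairing h (tnth (Eall fr t) j) = 0 &
     forall j, pairing h (tnth (Fall fr t) j) = 0].
  have [sp tF _ _ _] := hfr t; split=> j.
  - have /jm [al [be [u [Cu ->]]]] := (sp _).1 (memv_span (mem_tnth j _)).
    by rewrite /q reduce_model //; exists al, be, u.
  - have /jm [al [be [u [Cu ->]]]] := (sp _).1 (memv_span (mem_tnth j _)).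
    by rewrite ham_dir_model.
  have [t1 t2 t3] := tangent_unit_level r0 Ml (tF j).
  by apply: ham_dir_level t1 _; rewrite -pE.
have relE t i j : pairing (q (tnth (Eall fr t) i)) (q (tnth (Fall fr t) j)) = (i == j)%:R.
  have [_ _ /(_ i j) [_ _ s1] _ _] := hfr t; have [_ h1 h2] := hd t.
  by rewrite sigmaE in s1; rewrite /q pairing_reduce ?h1 ?h2.
have relF t i j : pairing (q (tnth (Fall fr t) i)) (q (tnth (Fall fr t) j)) = 0.
  have [_ _ /(_ i j) [_ s1 _] _ _] := hfr t; have [_ _ h2] := hd t.
  by rewrite sigmaE in s1; rewrite /q pairing_reduce ?h2.
have tE t := (frame_tnth fr t).1.
have tF t := (frame_tnth fr t).2.
have dm t f u : deriv_mod (hvec lam) f t u -> is_derive t 1 (fun s => q (f s)) (q u).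
  by rewrite hE; exact: reduce_deriv_mod.
have qsum m (a : 'I_m -> R) (x : 'I_m -> Phase R n) :
   q (\sum_i a i *: x i) = \sum_i a i *: q (x i).
  by rewrite /q reduce_sum; apply: eq_bigr => i _; rewrite reduceZ.
have dEa (t : R) : is_derive t 1 (fun t => q (Ea fr t)) (q (Eb fr t)).
  by apply: dm; have [_ _ _ [] //] := hfr t.
have dEb (t : R) : is_derive t 1 (fun t => q (Eb fr t)) (q (Fb fr t)).
  by apply: dm; have [_ _ _ [] //] := hfr t.
have dEc j (t : R) : is_derive t 1 (fun t => q (tnth (Ec fr t) j)) (q (tnth (Fc fr t) j)).
  by apply: (dm _ (fun s => tnth (Ec fr s) j)); have [_ _ _ [_ _ d] _] := hfr t; exact: d.
have dFa (t : R) : is_derive t 1 (fun t => q (Fa fr t))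
    (- (Raa fr t *: q (Ea fr t)) - \sum_i Rac fr t i ord0 *: q (tnth (Ec fr t) i)).
  have [_ _ _ _ [/dm d _ _ _]] := hfr t.
  by move: d; rewrite /q reduceD !reduceN reduceZ -/q qsum.
have dFb (t : R) : is_derive t 1 (fun t => q (Fb fr t))
    (- q (Fa fr t) - Rbb fr t *: q (Eb fr t) - \sum_i Rbc fr t i ord0 *: q (tnth (Ec fr t) i)).
  have [_ _ _ _ [_ /dm d _ _]] := hfr t.
  by move: d; rewrite /q !reduceD !reduceN reduceZ -/q qsum.
have dFc j (t : R) : is_derive t 1 (fun t => q (tnth (Fc fr t) j))
    (- (Rac fr t j ord0 *: q (Ea fr t)) - Rbc fr t j ord0 *: q (Eb fr t)
      - \sum_i Rcc fr t i j *: q (tnth (Ec fr t) i)).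
  have [_ _ _ _ [_ _ /(_ j) d _]] := hfr t.
  have := dm _ (fun s => tnth (Fc fr s) j) _ d.
  by rewrite /q !reduceD !reduceN !reduceZ -/q qsum.
have sE t j : S t (q (tnth (Eall fr t) j)) by have [] := hd t.
have pab t : [/\ pairing (q (Ea fr t)) (q (Fa fr t)) = 1,
    pairing (q (Ea fr t)) (q (Fb fr t)) = 0, pairing (q (Eb fr t)) (q (Fa fr t)) = 0 &
    pairing (q (Eb fr t)) (q (Fb fr t)) = 1].
  have [e1 e2 _] := tE t; have [f1 f2 _] := tF t; rewrite -e1 -e2 -f1 -f2.
  by split; rewrite relE.
have pF t : pairing (q (Fa fr t)) (q (Fb fr t)) = 0.
  by have [f1 f2 _] := tF t; rewrite -f1 -f2 relF.
have pEF j t : [/\ pairing (q (tnth (Ec fr t) j)) (q (Fa fr t)) = 0,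
    pairing (q (tnth (Ec fr t) j)) (q (Fb fr t)) = 0,
    pairing (q (Ea fr t)) (q (tnth (Fc fr t) j)) = 0 &
    pairing (q (Eb fr t)) (q (tnth (Fc fr t) j)) = 0].
  have [e1 e2 e3] := tE t; have [f1 f2 f3] := tF t.
  rewrite -e1 -e2 -e3 -f1 -f2 -f3.
  by split; rewrite relE.
have pFc j t : pairing (q (tnth (Fc fr t) j)) (q (Fa fr t)) = 0 /\
    pairing (q (tnth (Fc fr t) j)) (q (Fb fr t)) = 0.
  by have [f1 f2 f3] := tF t; rewrite -f1 -f2 -f3 !relF.
have pcc i j t : pairing (q (tnth (Ec fr t) i)) (q (tnth (Fc fr t) j)) = (i == j)%:R.
  have [_ _ e3] := tE t; have [_ _ f3] := tF t; rewrite -e3 -f3.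
  by rewrite relE !(inj_eq lift_inj).
have sEa t : S t (q (Ea fr t)) by have [<- _ _] := tE t.
have sEb t : S t (q (Eb fr t)) by have [_ <- _] := tE t.
have sEc j t : S t (q (tnth (Ec fr t) j)) by have [_ _ <-] := tE t.
have N := DarbouxFrame dEa dEb dEc dFa dFb dFc sEa sEb sEc pab pF pEF pFc pcc.
have main := normal_frame_rigid (explicit_model_frame om0 mz zw zJw ww) N 0.
move: main => [ra rb rac rbc [a [y [a2 Eae Ebe yP]]]].
have q0 x : x \in span (Eall fr 0) -> q x = x.
  have [sp _ _ _ _] := hfr 0.
  move=> /sp /jm [al [be [u [Cu ->]]]]; rewrite /q /reduce.
  suff -> : dot w (al *: model_a k om z w (covec_a k om z w) 0 + be *: model_b k om z w (covec_a k om z w) 0 +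
   model_c om u 0).2 = 0 by rewrite scale0r subr0.
  rewrite /= !mulr0 sin0 cos0 !mul0r !subrr !mul0r !scaler0 !scale0r.
  by rewrite !(addr0, subr0, oppr0, scaler0) dot0r.
split=> //.
- by apply/colP => i; rewrite rac mxE.
- by apply/colP => i; rewrite rbc mxE.
exists a, y; split=> // [|j].
  have [_ e2 _] := tE 0.
  rewrite -[LHS]q0; last by rewrite -e2 memv_span // mem_tnth.
  rewrite Ebe; congr (_ *: _); rewrite /model_b /to_vertical /vec_b.
  rewrite mulr0 sin0 cos0 !mul0r !subrr !mul0r !scale0r.
  by rewrite !(addr0, subr0, oppr0, scaler0, scale1r).
have [Cy yE yo yR] := yP j; split=> //.
have [_ _ e3] := tE 0.
rewrite -[LHS]q0; last by rewrite -e3 memv_span // mem_tnth.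
rewrite yE /model_c mulr0 sin0 cos0 mul0r scale1r scale0r addr0.
by [].
Qed.

End given_frame.

(** * The curvature of the Fubini-Study metric *)

Section fubini_study.
Context {R : realType} {n : nat}.
Implicit Types (X Y z u v w y p : CC R n) (r : R).
Implicit Types (nu : R) (J : CC R n -> CC R n -> CC R n).
Implicit Types (Gam : CC R n -> CC R n -> CC R n -> CC R n).

Lemma horizontal_mulI z X : horizontal z X -> horizontal z (mulI X).
Proof.
move=> [h1 h2]; split; rewrite ?dot_mulI // dot_mulIl h2 oppr0; done.
Qed.

Lemma horizontalD z X Y : horizontal z X -> horizontal z Y -> horizontal z (X + Y).
Proof. by move=> [a b] [c d]; split; rewrite dotDl ?a ?b ?c ?d addr0. Qed.
Lemma horizontalZ z (a : R) X : horizontal z X -> horizontal z (a *: X).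
Proof. by move=> [c d]; split; rewrite dotZl ?c ?d mulr0. Qed.

Lemma FS_center r z X Y : 0 < r -> sphere r z -> horizontal z X -> horizontal z Y ->
  FS r z X Y = dot X Y.
Proof.
move=> r0 zz [h1 h2] [h3 h4]; have rn0 : r != 0 by rewrite gt_eqF.
rewrite /FS hor_dot [dot z z]zz h1 h2 h3 h4 mulfV ?sqrf_eq0 //; ring.
Qed.

Lemma FS_chartE r z w X Y : 0 < r -> sphere r z ->
  horizontal z w -> horizontal z X -> horizontal z Y ->
  FS_chart r z w X Y = r ^+ 2 / (r ^+ 2 + dot w w) *
    (dot X Y - (dot X w * dot Y w + dot X (mulI w) * dot Y (mulI w)) / (r ^+ 2 + dot w w)).
Proof.
move=> r0 zz [w1 w2] [h1 h2] [h3 h4].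
have D : dot (z + w) (z + w) = r ^+ 2 + dot w w.
  by rewrite !dotE (dotC z w) w1 [dot z z]zz; ring.
rewrite /FS_chart /FS hor_dot D !mulIE !dotDr h1 h2 h3 h4 !add0r; ring.
Qed.

(** A horizontal vector that the chart maps to zero is a combination of [z + w]
    and [i (z + w)], whose coefficients are read off by pairing with [z] and
    [i z]. *)
Lemma FS_chart_nondegenerate r z w X : 0 < r -> sphere r z ->
  horizontal z w -> horizontal z X ->
  (forall Y, horizontal z Y -> FS_chart r z w X Y = 0) -> X = 0.
Proof.
move=> r0 zz hw hX /(_ _ hX); rewrite /FS_chart /FS.
have [w1 w2] := hw; have [h1 h2] := hX.
have rr : 0 < r ^+ 2 by rewrite exprn_gt0.
have D : dot (z + w) (z + w) = r ^+ 2 + dot w w.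
  by rewrite !dotE (dotC z w) w1 [dot z z]zz; ring.
have D0 : 0 < r ^+ 2 + dot w w by rewrite ltr_wpDr ?dot_ge0.
rewrite D => /eqP; rewrite mulf_eq0 gt_eqF ?divr_gt0 //= => /eqP /dot_eq0.
rewrite /hor; set a := _ / _; set b := _ / _ => E.
have XE : X = a *: (z + w) + b *: mulI (z + w).
  by apply/eqP; rewrite -subr_eq0 opprD addrA E.
have a0 : a = 0.
  have : a * r ^+ 2 = 0.
    rewrite -h1 XE !dotE mulIE !dotE (dotC (mulI z)) dot_mulIr w1 dot_mulIl w2 [dot z z]zz; ring.
  by move/eqP; rewrite mulf_eq0 (gt_eqF rr) orbF => /eqP.
have b0 : b = 0.
  have : b * r ^+ 2 = 0.
    by rewrite -h2 XE a0 !mulIE !dotE !dot_mulI !(dotC z) w1 [dot z z]zz; ring.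
  by move/eqP; rewrite mulf_eq0 (gt_eqF rr) orbF => /eqP.
by rewrite XE a0 b0 !scale0r addr0.
Qed.

(** The complex expression [h(u, w) v + h(v, w) u], with [h] the Hermitian product;
    the Christoffel symbol is [- 1 / (r^2 + |w|^2)] times it. *)
Definition FS_christoffel_num w u v : CC R n :=
  dot u w *: v + dot u (mulI w) *: mulI v + dot v w *: u + dot v (mulI w) *: mulI u.

Lemma FS_chart_derive r z w X Y v : 0 < r -> sphere r z -> horizontal z w ->
  horizontal z X -> horizontal z Y -> horizontal z v ->
  let rho := r ^+ 2 + dot w w in
  'D_v (fun w' => FS_chart r z w' X Y) w =
    - (2 * r ^+ 2 * dot w v / rho ^+ 2) *
       (dot X Y - (dot X w * dot Y w + dot X (mulI w) * dot Y (mulI w)) / rho)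
    + r ^+ 2 / rho *
       (- (dot X v * dot Y w + dot X w * dot Y v + dot X (mulI v) * dot Y (mulI w)
           + dot X (mulI w) * dot Y (mulI v)) / rho
        + 2 * dot w v * (dot X w * dot Y w + dot X (mulI w) * dot Y (mulI w)) / rho ^+ 2).
Proof.
move=> r0 zz hw hX hY hv rho.
have rho0 : rho != 0 by rewrite gt_eqF // ltr_wpDr ?dot_ge0 // exprn_gt0.
apply: derive_val; apply: derive_line.
have -> : (fun s : R => FS_chart r z (s *: v + w) X Y) = fun s =>
   r ^+ 2 / (r ^+ 2 + dot (s *: v + w) (s *: v + w)) *
    (dot X Y - (dot X (s *: v + w) * dot Y (s *: v + w)
      + dot X (mulI (s *: v + w)) * dot Y (mulI (s *: v + w))) /
      (r ^+ 2 + dot (s *: v + w) (s *: v + w))).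
  by apply/funext => s; apply: FS_chartE => //; apply: horizontalD => //; exact: horizontalZ.
have H : is_derive (0 : R) 1 (fun s : R => s *: v + w) v.
  by der; rewrite scale1r addr0.
have e : 0 *: v + w = w by rewrite scale0r add0r.
der; rewrite ?e -?/rho // !dot0l (dotC v w).
by field.
Qed.

(** The candidate satisfies the Koszul formula, which determines the connection
    because the metric is nondegenerate. *)
Lemma FS_christoffelE r z w u v Gam : 0 < r -> sphere r z -> horizontal z w ->
  horizontal z u -> horizontal z v ->
  is_christoffel (horizontal z) (FS_chart r z) Gam ->
  Gam w u v = - (r ^+ 2 + dot w w)^-1 *: FS_christoffel_num w u v.
Proof.
move=> r0 zz hw hu hv /(_ w u v hw hu hv) [hG GE].
apply/eqP; rewrite -subr_eq0; apply/eqP.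
have hN : horizontal z (FS_christoffel_num w u v).
  rewrite /FS_christoffel_num; repeat apply: horizontalD; apply: horizontalZ => //;
   exact: horizontal_mulI.
have hm : horizontal z (- - (r ^+ 2 + dot w w)^-1 *: FS_christoffel_num w u v).
  exact: horizontalZ.
rewrite -scaleNr.
apply: (@FS_chart_nondegenerate r z w _ r0 zz hw (horizontalD hG hm)) => y hy.
have := GE y hy.
rewrite !(FS_chart_derive r0 zz hw) // !FS_chartE //; last exact: horizontalD.
rewrite -/(FS_christoffel_num w u v).
set rho := r ^+ 2 + dot w w.
have rho0 : rho != 0 by rewrite gt_eqF // ltr_wpDr ?dot_ge0 // exprn_gt0.
have rn0 : r != 0 by rewrite gt_eqF.
have anti (a b : CC R n) : dot a (mulI b) = - dot b (mulI a) by rewrite dotC dot_mulIl.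
rewrite !dotDl !dotZl /FS_christoffel_num !dotDl !dotZl !dot_mulI !dot_mulIl.
rewrite (dotC v u) (dotC y u) (dotC y v) (dotC w u) (dotC w v) (dotC w y).
rewrite (anti v u) (anti y u) (anti y v) => K.
move/eqP: K; rewrite -subr_eq0 => /eqP K.
have two0 : (2 : R) != 0 by rewrite pnatr_eq0.
apply: (mulfI two0); rewrite mulr0 -K; field.
by rewrite rho0.
Qed.

Lemma horizontal0 z : horizontal z 0.
Proof. by split; rewrite dot0l. Qed.

Lemma FS_christoffel_derive r z u v y Gam : 0 < r -> sphere r z ->
  horizontal z u -> horizontal z v -> horizontal z y ->
  is_christoffel (horizontal z) (FS_chart r z) Gam ->
  'D_v (fun w => Gam w u y) 0 = - (r ^+ 2)^-1 *: FS_christoffel_num v u y.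
Proof.
move=> r0 zz hu hv hy hG; have rr : 0 < r ^+ 2 by rewrite exprn_gt0.
apply: derive_val; apply: derive_line.
have -> : (fun s : R => Gam (s *: v + 0) u y) =
   (fun s => (- (r ^+ 2 + s ^+ 2 * dot v v)^-1 * s) *: FS_christoffel_num v u y).
  apply/funext => s; rewrite addr0 (FS_christoffelE r0 zz _ hu hy hG); last exact: horizontalZ.
  rewrite !dotE -!scalerA mulrA -expr2; congr (_ *: _).
  by rewrite /FS_christoffel_num mulIZ !dotZr !scalerDr !scalerA.
der; first by rewrite expr0n mul0r addr0 gt_eqF.
by congr (_ *: _); rewrite expr0n mul0r addr0; ring.
Qed.

Lemma FS_christoffel0 r z u v Gam : 0 < r -> sphere r z ->
  horizontal z u -> horizontal z v ->
  is_christoffel (horizontal z) (FS_chart r z) Gam -> Gam 0 u v = 0.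
Proof.
move=> r0 zz hu hv hG; rewrite (FS_christoffelE r0 zz (horizontal0 z) hu hv hG).
by rewrite /FS_christoffel_num mulI0 !dot0r !scale0r !addr0 scaler0.
Qed.

(** The Christoffel symbols vanish at the origin of the chart, so only their
    derivatives contribute. *)
Lemma FS_riemann r z u v y Gam : 0 < r -> sphere r z ->
  horizontal z u -> horizontal z v -> horizontal z y ->
  is_christoffel (horizontal z) (FS_chart r z) Gam ->
  riemann Gam 0 u v y = (r ^+ 2)^-1 *:
    (dot u y *: v - dot v y *: u + dot (mulI u) y *: mulI v - dot (mulI v) y *: mulI u
     + (2 * dot (mulI u) v) *: mulI y).
Proof.
move=> r0 zz hu hv hy hG; rewrite /riemann.
rewrite !(FS_christoffel_derive r0 zz) //.
rewrite (FS_christoffel0 r0 zz hu hy hG) (FS_christoffel0 r0 zz hv hy hG).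
rewrite !(FS_christoffel0 r0 zz _ (horizontal0 z) hG) //.
rewrite /FS_christoffel_num (dotC v u) (dotC y u) (dotC y v).
have -> : dot u (mulI v) = - dot (mulI u) v by rewrite dot_mulIl opprK.
rewrite (dotC y (mulI u)) (dotC y (mulI v)) (dotC v (mulI u)).
by coords; ring.
Qed.

(** The form [d omega] is [2 / (nu r^2)] times the Kaehler form. *)
Lemma curvature_tensorE r nu J z X : 0 < r -> 0 < nu -> sphere r z -> horizontal z X ->
  curvature_tensor r nu J -> J z X = (2 / (nu * r ^+ 2)) *: mulI X.
Proof.
move=> r0 nu0 zz hX /(_ z X zz hX) [hJ JE].
have rn0 : r != 0 by rewrite gt_eqF. have nn0 : nu != 0 by rewrite gt_eqF.
have D u v : horizontal z u -> 'D_u (connection nu ^~ v) z =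
    dot (mulI u) v / (nu * r ^+ 2).
  move=> [u1 u2]; apply: derive_val; apply: derive_line.
  have -> : (fun s : R => connection nu (s *: u + z) v) = fun s =>
     dot (mulI (s *: u + z)) v / (nu * dot (s *: u + z) (s *: u + z)).
    apply/funext => s; rewrite /connection /vert !dotZl !dotZr dot_mulI.
    have [->|d0] := eqVneq (dot (s *: u + z) (s *: u + z)) 0; first by rewrite !mulr0 invr0 !mulr0.
    by field; rewrite nn0 d0.
  have H : is_derive (0 : R) 1 (fun s : R => s *: u + z) u.
    by der; rewrite scale1r addr0.
  have e : 0 *: u + z = z by rewrite scale0r add0r.
  der; rewrite ?e [dot z z]zz; first by rewrite mulf_neq0 // sqrf_eq0.
  by rewrite (dotC z) u1 dot0r; field; rewrite nn0 rn0.
set c := _ / _.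
have hY : horizontal z (J z X + - c *: mulI X).
  by apply: horizontalD => //; apply: horizontalZ; exact: horizontal_mulI.
apply/eqP; rewrite -subr_eq0 -scaleNr; apply/eqP; apply: dot_eq0.
set Y := J z X + _ in hY *.
rewrite {1}/Y dotDl dotZl -(FS_center r0 zz hJ hY) (JE _ hY) /ext_deriv !D //.
rewrite dot_mulIl (dotC (mulI Y) X) /c.
by field; rewrite nn0 rn0.
Qed.

(** The square of [J] is [- (2 / (nu r^2))^2], with a positive constant in the
    parentheses. *)
Lemma kahlerian_mulI r nu J z X : 0 < r -> 0 < nu -> sphere r z -> horizontal z X -> X <> 0 ->
  curvature_tensor r nu J -> kahlerian r J -> nu * r ^+ 2 = 2 /\ J z X = mulI X.
Proof.
move=> r0 nu0 zz hX X0 hJ hK.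
have JE Y : horizontal z Y -> J z Y = (2 / (nu * r ^+ 2)) *: mulI Y.
  by move=> hY; exact: (curvature_tensorE r0 nu0 zz hY hJ).
have hm := horizontal_mulI hX.
have := hK z X zz hX; rewrite !JE //; last exact: horizontalZ.
set c := 2 / _ => E.
have d0 : 0 < nu * r ^+ 2 by rewrite mulr_gt0 // exprn_gt0.
have c0 : 0 < c by rewrite divr_gt0.
have c1 : c = 1.
  have XX : dot X X != 0 by apply/eqP => /dot_eq0.
  have : c ^+ 2 * dot X X = dot X X.
    have := congr1 (fun Y => - dot Y X) E; rewrite mulIZ mulII !dotE opprK => h; rewrite -[RHS]h; ring.
  move/eqP; rewrite -subr_eq0 -{2}[dot X X]mul1r -mulrBl mulf_eq0 (negPf XX) orbF.
  by rewrite subr_sqr_1 mulf_eq0 subr_eq0 => /orP[/eqP //|]; rewrite gt_eqF // addr_gt0.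
split; last by rewrite c1 scale1r.
by have := c1; rewrite /c => /(congr1 ( *%R^~ (nu * r ^+ 2))); rewrite divfK ?gt_eqF // mul1r.
Qed.

End fubini_study.

(** * The curvature maps *)

Section curvature_maps.
Context {R : realType} {n : nat}.

Lemma hor_id (z X : CC R n) : horizontal z X -> hor z X = X.
Proof. by move=> [h1 h2]; rewrite /hor h1 h2 !mul0r !scale0r !subr0. Qed.

Lemma to_vertical_sum m (c : 'I_m -> R) (y : 'I_m -> CC R n) :
  to_vertical (\sum_i c i *: y i) = \sum_i c i *: to_vertical (y i).
Proof.
elim/big_ind2 : _ => [//|u a v b <- <-|i _]; apply: injective_projections => //=.
- by rewrite addr0.
- by rewrite scaler0.
Qed.

Lemma map_of_matrix0 m k (X : m.-tuple (Phase R n)) (Y : k.-tuple (Phase R n)) (v : Phase R n) :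
  map_of_matrix X Y 0 v = 0.
Proof.
rewrite /map_of_matrix big1 // => i _; rewrite big1 ?scale0r // => j _.
by rewrite mxE mul0r.
Qed.

Lemma map_of_scalar_matrix m (X : m.-tuple (Phase R n)) (a : R) (v : Phase R n) :
  v \in span X -> map_of_matrix X X a%:M v = a *: v.
Proof.
move=> vX; rewrite {2}(coord_span vX) scaler_sumr; apply: eq_bigr => i _.
rewrite (bigD1 i) //= big1 => [|j ji]; last by rewrite mxE eq_sym (negPf ji) mulr0n mul0r.
by rewrite mxE eqxx mulr1n addr0 scalerA -tnth_nth.
Qed.

End curvature_maps.

Theorem theorem2 (R : realType) (n : nat) (r nu : R)
    (J : CC R n -> CC R n -> CC R n)
    (hvec : Phase R n -> Phase R n) (flow : R -> Phase R n -> Phase R n)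
    (p z : CC R n) (Gam : CC R n -> CC R n -> CC R n -> CC R n)
    (fr : moving_frame R n)
    (hn : (1 <= n)%N) (hr : 0 < r) (hnu : 0 < nu)
    (hJ : curvature_tensor r nu J) (hK : kahlerian r J)
    (hham : hamiltonian_field r hvec)
    (hflow : is_flow (cotangent r) hvec flow)
    (hlam : unit_level r (p, z))
    (hGam : is_christoffel (horizontal z) (FS_chart r z) Gam)
    (hfr : normal_frame r hvec flow (p, z) fr) :
  let lam : Phase R n := (p, z) in
  let g := FS r z in
  let Rnabla := riemann Gam 0 in
  let ph := hor z p in
  let Jph := J z ph in
  (forall v, v \in Vc fr ->
     let vh := to_base lam v in
     [/\ g (to_base lam (curv_cc fr v)) vh =
           g (Rnabla ph vh ph) vh + u0 nu lam ^+ 2 / 4 * sqnorm_c fr v,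
         curv_cb fr v = g (Rnabla ph Jph ph) vh *: to_vertical Jph &
         curv_ca fr v = 0]) /\
  (forall rho : R,
     (forall vb, vb \in Vb fr -> curv_bb fr vb = rho *: vb) <->
     rho = g (Rnabla ph Jph ph) Jph + u0 nu lam ^+ 2) /\
  (forall va, va \in Va fr -> curv_aa fr va = 0).
Proof.
move=> lam g Rnabla ph Jph.
have rn0 : r != 0 by rewrite gt_eqF.
have [[zz pz] _] := hlam; rewrite /= in zz pz.
have := normal_frame_curvature hr hham hflow hlam hfr.
have [/frame_dots fd _] := unit_level_dots hr hlam.
rewrite [(p, z).2]/= in fd *.
have phE : velocity r (p, z) = ph.
  rewrite /velocity /ham_field /ph /hor /momentum /= pz mul0r scale0r subr0.
  by rewrite [dot z z]zz.
set k := momentum r (p, z); set om := frequency r k.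
rewrite phE in fd *.
clearbody ph.
move=> [raa rbb rac rbc [a [y [a2 Ebe yP]]]].
have hph : horizontal z ph by split; rewrite fd.
have ph0 : ph <> 0 by move=> e; have := fd.1.1.1.1.1.2; rewrite e dot0l => /eqP; rewrite eq_sym oner_eq0.
have [nur JphE] := kahlerian_mulI hr hnu zz hph ph0 hJ hK.
have hJph : horizontal z (mulI ph) by exact: horizontal_mulI.
have u0E : u0 nu lam = 2 * k.
  have -> : nu = 2 / r ^+ 2 by rewrite -nur mulfK // sqrf_eq0.
  by rewrite /u0 /vert dotZr /k /momentum /=; field.
have om2 : om ^+ 2 = (r ^+ 2)^-1 + k ^+ 2 by exact: frequency2.
rewrite /Jph JphE.
have RJ : Rnabla ph (mulI ph) ph = (4 / r ^+ 2) *: mulI ph.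
  rewrite /Rnabla (FS_riemann hr zz) // !mulIE !dotE !fd.
  by coords; field.
have yN i j : dot (y i) (y j) = (i == j)%:R by have [_ _ h _] := yP i; exact: h.
have yh j : horizontal z (y j) by have [[h1 h2 _ _] _ _ _] := yP j.
split; last split.
- move=> v vV; set vh := to_base lam v.
  pose c j := coord (Ec fr 0) j v.
  pose Y := \sum_j c j *: y j.
  have vE : v = to_vertical Y.
    rewrite to_vertical_sum (coord_span vV); apply: eq_bigr => j _.
    by rewrite -tnth_nth; have [_ -> _ _] := yP j.
  have hY : horizontal z Y.
    apply: (big_ind (horizontal z)) => [|X X'|j _]; [exact: horizontal0|exact: horizontalD|].
    exact: horizontalZ.
  have dY X : dot Y X = \sum_j c j * dot (y j) X.
    by rewrite dot_suml; apply: eq_bigr => j _; rewrite dotZl.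
  have vhE : vh = Y by rewrite /vh /to_base vE /= hor_id.
  have Yph : dot Y ph = 0.
    by rewrite dY big1 // => j _; have [[_ _ -> _] _ _ _] := yP j; rewrite mulr0.
  have YJph : dot Y (mulI ph) = 0.
    by rewrite dY big1 // => j _; have [[_ _ _ ->] _ _ _] := yP j; rewrite mulr0.
  have YY : dot Y Y = sqnorm_c fr v.
    rewrite /sqnorm_c dY; apply: eq_bigr => i _.
    rewrite dotC dY (bigD1 i) //= big1 => [|j ji]; last by rewrite yN (negPf ji) mulr0n mulr0.
    by rewrite yN eqxx mulr1n mulr1 addr0 expr2.
  have RY : Rnabla ph Y ph = (r ^+ 2)^-1 *: Y.
    have JYph : dot (mulI Y) ph = 0 by rewrite dot_mulIl YJph oppr0.
    rewrite /Rnabla (FS_riemann hr zz) // (dotC (mulI ph) Y) YJph JYph Yph !fd.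
    by coords; ring.
  have ccE : curv_cc fr v = to_vertical (om ^+ 2 *: Y).
    rewrite /curv_cc /map_of_matrix.
    transitivity (\sum_i (\sum_j Rcc fr 0 i j * c j) *: to_vertical (y i)).
      by apply: eq_bigr => i _; have [_ -> _ _] := yP i.
    rewrite -to_vertical_sum; congr to_vertical.
    rewrite scaler_sumr.
    transitivity (\sum_i \sum_j (Rcc fr 0 i j * c j) *: y i).
      by apply: eq_bigr => i _; rewrite scaler_suml.
    rewrite exchange_big; apply: eq_bigr => j _.
    have [_ _ _ yR] := yP j; rewrite scalerA mulrC -scalerA -yR scaler_sumr.
    by apply: eq_bigr => i _; rewrite scalerA mulrC.
  split.
  + rewrite ccE vhE /to_base /= hor_id; last exact: horizontalZ.
    rewrite RY /g !(FS_center hr zz) //; try exact: horizontalZ.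
    by rewrite !dotZl YY om2 u0E; field.
  + rewrite /curv_cb rbc trmx0 map_of_matrix0 RJ vhE /g (FS_center hr zz) //; last exact: horizontalZ.
    by rewrite dotZl (dotC _ Y) YJph mulr0 scale0r.
  by rewrite /curv_ca rac trmx0 map_of_matrix0.
- move=> rho; rewrite RJ /g (FS_center hr zz) //; last exact: horizontalZ.
  rewrite dotZl fd mulr1 u0E.
  have -> : 4 / r ^+ 2 + (2 * k) ^+ 2 = Rbb fr 0 by rewrite rbb om2; field.
  split=> [H|-> vb vbV]; last exact: map_of_scalar_matrix.
  have EV : Eb fr 0 \in Vb fr by rewrite memv_span // mem_seq1.
  have := H _ EV; rewrite /curv_bb map_of_scalar_matrix // => /eqP.
  rewrite -subr_eq0 -scalerBl scaler_eq0 subr_eq0 => /orP[/eqP -> //|/eqP E0].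
  have a0 : a <> 0 by move=> a0; move: a2; rewrite a0 expr0n => /eqP; rewrite eq_sym oner_eq0.
  have := congr1 (fun x => dot x.1 (mulI ph)) (etrans (esym Ebe) E0).
  by rewrite /= dotZl fd mulr1 dot0l.
move=> va vaV; rewrite /curv_aa map_of_scalar_matrix // raa scale0r.
by [].
Qed.
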